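(* Assume the hypotheses in the context, with $c'(z)\le -m_0$ for all $z$ and $\psi_1(y)\ge\psi_0$ for all $y$. Then there exist constants $\lambda_0>0$, $\delta>0$ and $M>0$ such that for every $\lambda$ with $|\lambda|\le\lambda_0$ the problem \[ U_{1\tau}+\Lambda_+U_{1y}=G_1,\quad U_{2\tau}+\Lambda_-U_{2y}=G_2,\quad U_{3\tau}+\Lambda_+U_{3y}=G_3,\quad U_{4\tau}+\Lambda_-U_{4y}=G_4, \] with $U_i(0,y)=U_{i\tau}(0,y)=0$ ($i=1,2,3,4$, $y\in\mathbb{R}$), has a classical solution $\mathbf U=(U_1,U_2,U_3,U_4)^T$ on $[0,\delta]\times\mathbb{R}$ belonging to the function class $\mathcal F(M,\delta)$.
   Context: Hypotheses: $c,a:\mathbb{R}\to\mathbb{R}$ smooth with $c^{(l)},a^{(l)}$ bounded for $l=1,2,3$, $|a(z)|\ge m_0>0$; $\varphi_1$ a constant with $c(\varphi_1)=0$; $\varphi_2,\psi_1,\psi_2$ smooth with $\varphi_2^{(j)}$ ($j=1,\dots,4$), $\psi_1^{(k)},\psi_2^{(k)}$ ($k=0,\dots,3$) bounded. Let $u_*(\tau)$ be defined by $c(u_*(\tau))=-\tau$, $u_*(0)=\varphi_1$ (well defined as $c$ is strictly decreasing); below $c',a,a'$ denote $c'(u_*(\tau)),a(u_*(\tau)),a'(u_*(\tau))$. Define $f_{11}=a(\varphi_1)a'(\varphi_1)\psi_2^2+2\lambda a(\varphi_1)a'(\varphi_1)\varphi_2'$, $f_{21}=c'(\varphi_1)\psi_1\varphi_2'-\frac{2a'(\varphi_1)}{a(\varphi_1)}\psi_1\psi_2$,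 $f_{22}=-c'(\varphi_1)\psi_1\varphi_2'-\frac{2a'(\varphi_1)}{a(\varphi_1)}\psi_1\psi_2$ and $g_{1i}$... precisely $g_{11}=-\frac{f_{11}}{c'(\varphi_1)\psi_1}$, $g_{21}=-\frac{f_{21}}{c'(\varphi_1)\psi_1}$, $g_{22}=-\frac{f_{22}}{c'(\varphi_1)\psi_1}$ (functions of $y$). Given $\mathbf U$, set $R_1=U_1+\psi_1+g_{11}\tau$, $S_1=U_2+\psi_1+g_{11}\tau$, $R_2=U_3+\psi_2+g_{21}\tau$, $S_2=U_4+\psi_2+g_{22}\tau$, and $\Lambda_+=-\frac{\tau}{c'S_1}$, $\Lambda_-=\frac{\tau}{c'R_1}$. Define $G_1=\frac{(R_1+S_1)(R_1-S_1)}{4S_1\tau}+\frac{\lambda aa'(R_2-S_2)}{c'S_1\tau}-\frac{a^2(R_2-S_2)^2}{4S_1\tau}-\frac{aa'R_2S_2}{c'S_1}-g_{11}+\frac{\tau(\psi_1'+g_{11}'\tau)}{c'S_1}$, $G_2=\frac{(R_1+S_1)(S_1-R_1)}{4R_1\tau}+\frac{\lambda aa'(R_2-S_2)}{c'R_1\tau}-\frac{a^2(R_2-S_2)^2}{4R_1\tau}-\frac{aa'R_2S_2}{c'R_1}-g_{11}-\frac{\tau(\psi_1'+g_{11}'\tau)}{c'R_1}$, $G_3=\frac{R_1(R_2-S_2)}{2S_1\tau}-\frac{\lambda a'(R_1-S_1)}{ac'S_1\tau}+\frac{a'(R_1S_2+R_2S_1)}{ac'S_1}-g_{21}+\frac{\tau(\psi_2'+g_{21}'\tau)}{c'S_1}$,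 $G_4=\frac{S_1(S_2-R_2)}{2R_1\tau}-\frac{\lambda a'(R_1-S_1)}{ac'R_1\tau}+\frac{a'(R_1S_2+R_2S_1)}{ac'R_1}-g_{22}-\frac{\tau(\psi_2'+g_{22}'\tau)}{c'R_1}$. (This is the degenerate system for $R_1,S_1,R_2,S_2$ written in the partial hodograph variables $\tau=-c(u(t,x))$, $y=x$, after subtracting the first-order Taylor expansion in $\tau$ of the initial data.) Function class: $\mathcal F(M,\delta)$ is the set of continuously differentiable $\mathbf u=(u_1,u_2,u_3,u_4)^T:[0,\delta]\times\mathbb{R}\to\mathbb{R}^4$ such that (P1) $u_j(0,y)=u_{j\tau}(0,y)=0$ for $j=1,\dots,4$; (P2) $\sum_{j=1}^4\|u_j/\tau^2\|_{L^\infty}\le M$; (P3) $\sum_{j=1}^4\|u_{jy}/\tau^2\|_{L^\infty}\le M$; (P4) each $u_{jy}$ is Lipschitz continuous in $y$ and $\sum_{j=1}^4\|u_{jyy}/\tau^2\|_{L^\infty}\le M$. *)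

(* Defs.v *)
From Stdlib Require Import Reals Lra.
Open Scope R_scope.

Definition smooth_with (f : R -> R) (D : nat -> R -> R) : Prop :=
  (forall x, D 0%nat x = f x) /\
  (forall (n : nat) (x : R), derivable_pt_lim (D n) x (D (S n) x)).

Definition bounded_fn (f : R -> R) : Prop :=
  exists K : R, forall x, Rabs (f x) <= K.

(** Partial derivative in tau on the strip [0,d] x R (one-sided at the
    boundary lines tau = 0 and tau = d). *)
Definition pderiv_t (d : R) (f ft : R -> R -> R) : Prop :=
  forall t y, 0 <= t <= d ->
  forall eps, 0 < eps -> exists del, 0 < del /\
    forall h, h <> 0 -> Rabs h < del -> 0 <= t + h <= d ->
      Rabs ((f (t + h) y - f t y) / h - ft t y) < eps.

Definition pderiv_y (d : R) (f fy : R -> R -> R) : Prop :=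
  forall t y, 0 <= t <= d -> derivable_pt_lim (fun z => f t z) y (fy t y).

Definition cont_on (d : R) (F : R -> R -> R) : Prop :=
  forall t y, 0 <= t <= d ->
  forall eps, 0 < eps -> exists del, 0 < del /\
    forall t' y', 0 <= t' <= d -> Rabs (t' - t) < del -> Rabs (y' - y) < del ->
      Rabs (F t' y' - F t y) < eps.

Definition C1_on (d : R) (f ft fy : R -> R -> R) : Prop :=
  cont_on d f /\ pderiv_t d f ft /\ pderiv_y d f fy /\
  cont_on d ft /\ cont_on d fy.

Definition class_F (M d : R) (u ut uy : nat -> R -> R -> R) : Prop :=
  (forall j, (1 <= j <= 4)%nat -> C1_on d (u j) (ut j) (uy j)) /\
  (forall j, (1 <= j <= 4)%nat -> forall y, u j 0 y = 0 /\ ut j 0 y = 0) /\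
  (* (P2): sum_j || u_j / tau^2 ||_oo <= M *)
  (exists K : nat -> R,
     (forall j, (1 <= j <= 4)%nat -> forall t y, 0 < t <= d ->
        Rabs (u j t y) <= K j * t ^ 2) /\
     K 1%nat + K 2%nat + K 3%nat + K 4%nat <= M) /\
  (* (P3): sum_j || u_{jy} / tau^2 ||_oo <= M *)
  (exists K : nat -> R,
     (forall j, (1 <= j <= 4)%nat -> forall t y, 0 < t <= d ->
        Rabs (uy j t y) <= K j * t ^ 2) /\
     K 1%nat + K 2%nat + K 3%nat + K 4%nat <= M) /\
  (* (P4): u_{jy} Lipschitz in y with sum_j || u_{jyy} / tau^2 ||_oo <= M,
     expressed through Lipschitz constants K j * tau^2 *)
  (exists K : nat -> R,
     (forall j, (1 <= j <= 4)%nat -> forall t y1 y2, 0 < t <= d ->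
        Rabs (uy j t y1 - uy j t y2) <= K j * t ^ 2 * Rabs (y1 - y2)) /\
     K 1%nat + K 2%nat + K 3%nat + K 4%nat <= M).

(** f_{11}, f_{21}, f_{22}; here a1 = a(phi1), da1 = a'(phi1), dc1 = c'(phi1),
    dphi2 = phi2'. *)
Definition f11 (a1 da1 lam : R) (psi2 dphi2 : R -> R) (y : R) : R :=
  a1 * da1 * (psi2 y) ^ 2 + 2 * lam * a1 * da1 * dphi2 y.
Definition f21 (a1 da1 dc1 : R) (psi1 psi2 dphi2 : R -> R) (y : R) : R :=
  dc1 * psi1 y * dphi2 y - 2 * da1 / a1 * psi1 y * psi2 y.
Definition f22 (a1 da1 dc1 : R) (psi1 psi2 dphi2 : R -> R) (y : R) : R :=
  - (dc1 * psi1 y * dphi2 y) - 2 * da1 / a1 * psi1 y * psi2 y.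

Definition g11 (a1 da1 dc1 lam : R) (psi1 psi2 dphi2 : R -> R) (y : R) : R :=
  - (f11 a1 da1 lam psi2 dphi2 y / (dc1 * psi1 y)).
Definition g21 (a1 da1 dc1 : R) (psi1 psi2 dphi2 : R -> R) (y : R) : R :=
  - (f21 a1 da1 dc1 psi1 psi2 dphi2 y / (dc1 * psi1 y)).
Definition g22 (a1 da1 dc1 : R) (psi1 psi2 dphi2 : R -> R) (y : R) : R :=
  - (f22 a1 da1 dc1 psi1 psi2 dphi2 y / (dc1 * psi1 y)).

(** Right-hand sides. cp, aa, da stand for c'(u_*(t)), a(u_*(t)), a'(u_*(t));
    g, dg for g_{i1}(y) (resp. g_{2j}) and its y-derivative; dpsi for
    psi_1'(y) (resp. psi_2'(y)). *)
Definition G1 (lam cp aa da t R1 S1 R2 S2 g dg dpsi : R) : R :=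
  (R1 + S1) * (R1 - S1) / (4 * S1 * t)
  + lam * aa * da * (R2 - S2) / (cp * S1 * t)
  - aa ^ 2 * (R2 - S2) ^ 2 / (4 * S1 * t)
  - aa * da * R2 * S2 / (cp * S1)
  - g
  + t * (dpsi + dg * t) / (cp * S1).

Definition G2 (lam cp aa da t R1 S1 R2 S2 g dg dpsi : R) : R :=
  (R1 + S1) * (S1 - R1) / (4 * R1 * t)
  + lam * aa * da * (R2 - S2) / (cp * R1 * t)
  - aa ^ 2 * (R2 - S2) ^ 2 / (4 * R1 * t)
  - aa * da * R2 * S2 / (cp * R1)
  - g
  - t * (dpsi + dg * t) / (cp * R1).

Definition G3 (lam cp aa da t R1 S1 R2 S2 g dg dpsi : R) : R :=
  R1 * (R2 - S2) / (2 * S1 * t)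
  - lam * da * (R1 - S1) / (aa * cp * S1 * t)
  + da * (R1 * S2 + R2 * S1) / (aa * cp * S1)
  - g
  + t * (dpsi + dg * t) / (cp * S1).

Definition G4 (lam cp aa da t R1 S1 R2 S2 g dg dpsi : R) : R :=
  S1 * (S2 - R2) / (2 * R1 * t)
  - lam * da * (R1 - S1) / (aa * cp * R1 * t)
  + da * (R1 * S2 + R2 * S1) / (aa * cp * R1)
  - g
  - t * (dpsi + dg * t) / (cp * R1).

(* Main.v *)
(* Put U = t^2 v. The g_{ij} are chosen so that the terms of order t^0 in G_i cancel, and the
   system becomes
     U_t + t l(t,y,v) U_y = t p(t,y,v),  p = (v_a - v_b)/2 + lam A (v_c - v_e) + E,
   where A, E and l depend on v only through t v, hence have bounds independent of the size of
   v for small t. Integrating t p along characteristics gains a factor 1/2 from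
   int_0^t s ds = t^2/2, so the singular part (v_a - v_b)/2 contributes a contraction factor
   1/2; this leaves room for the lam-term and for E. The characteristics X(s;t,y) and v are
   found together as the fixed point of one contraction. The y-regularity is recorded by
   bounds on values, first and second differences, which survive limits and integrals; only
   at the end are they turned into a Lipschitz derivative. The flow is never differentiated:
   X(s;t',y) = X(s;t,X(t;t',y)) gives U(t',y) = U(t,X(t;t',y)) + int_t^{t'} s p ds, and the
   t-derivative follows from the y-derivative of U at the fixed time t. *)

Require Import Defs.
From Stdlib Require Import Reals Lra Lia Psatz FunctionalExtensionality.
From Coquelicot Require Import Coquelicot.
Open Scope R_scope.

(** * Triples of values and C^{1,1} functions *)

(** No continuity of v at t = 0 is available: only t^2 v is Lipschitz in time, and the fields t p
    and t l are continuous at t = 0 because of their factor t. Hence time regularity is always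
    stated for t^2 v, never for v.

    The iteration runs in sets cut out by non-strict inequalities between finitely many values, so
    that pointwise limits of iterates stay in them without any compactness argument.

    The numerical budget is (9/8)(5/4)/2 = 45/64 < 1. Here 5/4 bounds the source relative to K,
    perturbations included; 9/8 is the loss from composing with characteristics that differ from the
    identity by 1/32; 1/2 comes from the integral.

    The constants are chosen in this order: bounds for A, E and l, uniform in |lam| <= 1; then K
    from E and the threshold for lam from A; last the time d. So neither d nor M depends on lam. *)

Definition tri (e n K p q r : R) : Prop :=
  Rabs p <= K /\ Rabs q <= K /\ Rabs r <= K /\
  Rabs (p - q) <= K * e /\ Rabs (r - q) <= K * e /\
  Rabs (p - 2 * q + r) <= K * n.

Lemma tri_const (e n k : R) : 0 <= e -> 0 <= n -> tri e n (Rabs k) k k k.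
Proof.
  intros He Hn. pose proof (Rabs_pos k).
  repeat split; try lra;
  match goal with |- Rabs ?x <= _ => replace x with 0 by ring end;
  rewrite Rabs_R0; nra.
Qed.

Lemma tri_weaken (e n K K' p q r : R) :
  0 <= e -> 0 <= n -> K <= K' -> tri e n K p q r -> tri e n K' p q r.
Proof.
  intros He Hn HK (A & B & C & D & E & F).
  repeat split; try lra; eapply Rle_trans; try eassumption; nra.
Qed.

Lemma tri_plus (e n K K' p q r p' q' r' : R) :
  tri e n K p q r -> tri e n K' p' q' r' ->
  tri e n (K + K') (p + p') (q + q') (r + r').
Proof.
  intros (A & B & C & D & E & F) (A' & B' & C' & D' & E' & F').
  repeat split.
  - eapply Rle_trans; [apply Rabs_triang | lra].
  - eapply Rle_trans; [apply Rabs_triang | lra].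
  - eapply Rle_trans; [apply Rabs_triang | lra].
  - replace (p + p' - (q + q')) with ((p - q) + (p' - q')) by ring.
    eapply Rle_trans; [apply Rabs_triang | lra].
  - replace (r + r' - (q + q')) with ((r - q) + (r' - q')) by ring.
    eapply Rle_trans; [apply Rabs_triang | lra].
  - replace (p + p' - 2 * (q + q') + (r + r'))
      with ((p - 2 * q + r) + (p' - 2 * q' + r')) by ring.
    eapply Rle_trans; [apply Rabs_triang | lra].
Qed.

Lemma tri_scal (e n K k p q r : R) :
  tri e n K p q r -> tri e n (Rabs k * K) (k * p) (k * q) (k * r).
Proof.
  intros (A & B & C & D & E & F). pose proof (Rabs_pos k).
  repeat split.
  - rewrite Rabs_mult; nra.
  - rewrite Rabs_mult; nra.
  - rewrite Rabs_mult; nra.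
  - replace (k * p - k * q) with (k * (p - q)) by ring. rewrite Rabs_mult; nra.
  - replace (k * r - k * q) with (k * (r - q)) by ring. rewrite Rabs_mult; nra.
  - replace (k * p - 2 * (k * q) + k * r) with (k * (p - 2 * q + r)) by ring.
    rewrite Rabs_mult; nra.
Qed.

Lemma tri_opp (e n K p q r : R) : tri e n K p q r -> tri e n K (- p) (- q) (- r).
Proof.
  intros H. apply (tri_scal e n K (Ropp 1)) in H.
  rewrite Rabs_Ropp, Rabs_R1, Rmult_1_l in H.
  replace (- p) with (Ropp 1 * p) by ring. replace (- q) with (Ropp 1 * q) by ring.
  replace (- r) with (Ropp 1 * r) by ring. exact H.
Qed.

Lemma tri_minus (e n K K' p q r p' q' r' : R) :
  tri e n K p q r -> tri e n K' p' q' r' ->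
  tri e n (K + K') (p - p') (q - q') (r - r').
Proof. intros H H'. apply tri_plus; [exact H | apply tri_opp, H']. Qed.

Lemma Rabs_plus_le (x y a b : R) : Rabs x <= a -> Rabs y <= b -> Rabs (x + y) <= a + b.
Proof. intros Hx Hy. eapply Rle_trans; [apply Rabs_triang | lra]. Qed.

Lemma Rabs_minus_le (x y a b : R) : Rabs x <= a -> Rabs y <= b -> Rabs (x - y) <= a + b.
Proof. intros Hx Hy. apply Rabs_plus_le; [| rewrite Rabs_Ropp]; assumption. Qed.

Lemma Rabs_mult_le (x y a b : R) : Rabs x <= a -> Rabs y <= b -> Rabs (x * y) <= a * b.
Proof.
  intros Hx Hy. rewrite Rabs_mult.
  pose proof (Rabs_pos x). pose proof (Rabs_pos y). nra.
Qed.

(** Discrete Leibniz rule. The second difference of a product contains two products of first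
    differences, each of size K K' e^2; they are the reason for requiring e^2 <= n, and 1 + 1 + 2
    gives the factor 4. *)
Lemma tri_mult (e n K K' p q r p' q' r' : R) :
  0 <= e -> e ^ 2 <= n -> tri e n K p q r -> tri e n K' p' q' r' ->
  tri e n (4 * K * K') (p * p') (q * q') (r * r').
Proof.
  intros He Hn (A & B & C & D & E & F) (A' & B' & C' & D' & E' & F').
  assert (HK : 0 <= K) by (pose proof (Rabs_pos p); lra).
  assert (HK' : 0 <= K') by (pose proof (Rabs_pos p'); lra).
  assert (HKK : 0 <= K * K') by nra.
  assert (HKe : 0 <= K * K' * e) by nra.
  assert (HKn : K * K' * e ^ 2 <= K * K' * n) by (apply Rmult_le_compat_l; lra).
  repeat split.
  - pose proof (Rabs_mult_le _ _ _ _ A A'). lra.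
  - pose proof (Rabs_mult_le _ _ _ _ B B'). lra.
  - pose proof (Rabs_mult_le _ _ _ _ C C'). lra.
  - replace (p * p' - q * q') with ((p - q) * p' + q * (p' - q')) by ring.
    pose proof (Rabs_mult_le _ _ _ _ D A'). pose proof (Rabs_mult_le _ _ _ _ B D').
    eapply Rle_trans; [apply Rabs_triang | lra].
  - replace (r * r' - q * q') with ((r - q) * r' + q * (r' - q')) by ring.
    pose proof (Rabs_mult_le _ _ _ _ E C'). pose proof (Rabs_mult_le _ _ _ _ B E').
    eapply Rle_trans; [apply Rabs_triang | lra].
  - replace (p * p' - 2 * (q * q') + r * r') with
      ((p - 2 * q + r) * q' + q * (p' - 2 * q' + r')
       + ((p - q) * (p' - q') + (r - q) * (r' - q'))) by ring.
    pose proof (Rabs_mult_le _ _ _ _ F B'). pose proof (Rabs_mult_le _ _ _ _ B F').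
    pose proof (Rabs_mult_le _ _ _ _ D D'). pose proof (Rabs_mult_le _ _ _ _ E E').
    eapply Rle_trans;
      [repeat apply Rabs_plus_le; eassumption |]. lra.
Qed.

(** The three summands of the constant bound 1/x and the discrete analogues of its first and second
    derivatives, where p, q, r play the role of a function with constant K. *)
Lemma tri_inv (e n K m p q r : R) :
  0 <= e -> e ^ 2 <= n -> 0 < m -> m <= p -> m <= q -> m <= r -> tri e n K p q r ->
  tri e n (/ m + K / m ^ 2 + 2 * K ^ 2 / m ^ 3) (/ p) (/ q) (/ r).
Proof.
  intros He Hn Hm Hp Hq Hr (A & B & C & D & E & F).
  assert (HK : 0 <= K) by (pose proof (Rabs_pos p); lra).
  assert (Hi : 0 < / m) by (apply Rinv_0_lt_compat; lra).
  set (i := / m) in *.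
  replace (K / m ^ 2) with (K * i ^ 2) by (unfold i; field; lra).
  replace (2 * K ^ 2 / m ^ 3) with (2 * K ^ 2 * i ^ 3) by (unfold i; field; lra).
  assert (inv_le : forall x, m <= x -> Rabs (/ x) <= i).
  { intros x Hx. rewrite Rabs_right; [apply Rinv_le_contravar; lra |].
    apply Rle_ge, Rlt_le, Rinv_0_lt_compat; lra. }
  pose proof (inv_le p Hp) as Ip. pose proof (inv_le q Hq) as Iq.
  pose proof (inv_le r Hr) as Ir.
  assert (P2 : 0 <= K * i ^ 2) by (apply Rmult_le_pos; [lra | apply pow_le; lra]).
  assert (P3 : 0 <= 2 * K ^ 2 * i ^ 3).
  { apply Rmult_le_pos; [pose proof (pow2_ge_0 K); lra | apply pow_le; lra]. }
  assert (Hn0 : 0 <= n) by (pose proof (pow2_ge_0 e); lra).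
  repeat split; try lra.
  - replace (/ p - / q) with (- ((p - q) * (/ p * / q))) by (field; lra).
    rewrite Rabs_Ropp.
    pose proof (Rabs_mult_le _ _ _ _ D (Rabs_mult_le _ _ _ _ Ip Iq)). nra.
  - replace (/ r - / q) with (- ((r - q) * (/ r * / q))) by (field; lra).
    rewrite Rabs_Ropp.
    pose proof (Rabs_mult_le _ _ _ _ E (Rabs_mult_le _ _ _ _ Ir Iq)). nra.
  - replace (/ p - 2 * / q + / r) with
      (- ((p - 2 * q + r) * (/ q * / q))
       + (((p - q) * (p - q)) * (/ p * (/ q * / q))
          + ((r - q) * (r - q)) * (/ r * (/ q * / q)))) by (field; lra).
    pose proof (Rabs_mult_le _ _ _ _ Iq Iq) as Iqq.
    pose proof (Rabs_mult_le _ _ _ _ F Iqq) as X1.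
    pose proof (Rabs_mult_le _ _ _ _ (Rabs_mult_le _ _ _ _ D D)
                  (Rabs_mult_le _ _ _ _ Ip Iqq)) as X2.
    pose proof (Rabs_mult_le _ _ _ _ (Rabs_mult_le _ _ _ _ E E)
                  (Rabs_mult_le _ _ _ _ Ir Iqq)) as X3.
    eapply Rle_trans; [apply Rabs_triang |]. rewrite Rabs_Ropp.
    eapply Rle_trans; [apply Rplus_le_compat_l, Rabs_triang |].
    assert (0 <= i * n) by nra.
    assert (K ^ 2 * i ^ 3 * e ^ 2 <= K ^ 2 * i ^ 3 * n) by (apply Rmult_le_compat_l; lra).
    lra.
Qed.

(* [tri (Rabs h) (h ^ 2)] at equally spaced points controls [f], its Lipschitz constant
   and its second differences at once; unlike bounds on [f'] and [f''], this passes to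
   pointwise limits and under integrals without any differentiation. *)
Definition C11 (K : R) (f : R -> R) : Prop :=
  forall y h, tri (Rabs h) (h ^ 2) K (f (y + h)) (f y) (f (y - h)).

Lemma C11_bound (K : R) (f : R -> R) (y : R) : C11 K f -> Rabs (f y) <= K.
Proof. intros H. apply (H y 0). Qed.

Lemma C11_ge0 (K : R) (f : R -> R) : C11 K f -> 0 <= K.
Proof. intros H. pose proof (C11_bound K f 0 H). pose proof (Rabs_pos (f 0)). lra. Qed.

Lemma C11_lip (K : R) (f : R -> R) (y z : R) :
  C11 K f -> Rabs (f y - f z) <= K * Rabs (y - z).
Proof.
  intros H. destruct (H z (y - z)) as (_ & _ & _ & D & _).
  replace (z + (y - z)) with y in D by ring. exact D.
Qed.

(** The point z is compared with the reflection 2y - x of x in y; the defect x - 2y + z is paid for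
    by the Lipschitz bound. *)
Lemma C11_second (K : R) (f : R -> R) (x y z : R) :
  C11 K f ->
  Rabs (f x - 2 * f y + f z) <= K * (x - y) ^ 2 + K * Rabs (x - 2 * y + z).
Proof.
  intros H. destruct (H y (x - y)) as (_ & _ & _ & _ & _ & F).
  replace (y + (x - y)) with x in F by ring.
  replace (f x - 2 * f y + f z)
    with ((f x - 2 * f y + f (y - (x - y))) + (f z - f (y - (x - y)))) by ring.
  pose proof (C11_lip K f z (y - (x - y)) H) as L.
  replace (z - (y - (x - y))) with (x - 2 * y + z) in L by ring.
  eapply Rle_trans; [apply Rabs_triang | lra].
Qed.

Lemma C11_tri (K e n : R) (f : R -> R) (x y z : R) :
  C11 K f -> e ^ 2 <= n -> Rabs (x - y) <= e -> Rabs (z - y) <= e ->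
  Rabs (x - 2 * y + z) <= n -> tri e n (2 * K) (f x) (f y) (f z).
Proof.
  intros H Hn Hx Hz Hs. pose proof (C11_ge0 K f H) as HK.
  assert (He : 0 <= e) by (pose proof (Rabs_pos (x - y)); lra).
  repeat split.
  - pose proof (C11_bound K f x H); lra.
  - pose proof (C11_bound K f y H); lra.
  - pose proof (C11_bound K f z H); lra.
  - pose proof (C11_lip K f x y H); nra.
  - pose proof (C11_lip K f z y H); nra.
  - pose proof (C11_second K f x y z H) as S.
    assert ((x - y) ^ 2 <= e ^ 2).
    { rewrite <- (Rsqr_pow2 (x - y)), <- Rsqr_pow2. apply Rsqr_le_abs_1.
      rewrite (Rabs_right e); lra. }
    nra.
Qed.

(** The second difference costs (1 + mu)^2 + mu = 1 + 3 mu + mu^2, which is at most 1 + 4 mu because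
    mu <= 1. *)
Lemma C11_comp (K mu : R) (f X : R -> R) :
  0 <= mu <= 1 -> C11 K f ->
  (forall y h, Rabs (X (y + h) - X y) <= (1 + mu) * Rabs h) ->
  (forall y h, Rabs (X (y + h) - 2 * X y + X (y - h)) <= mu * h ^ 2) ->
  C11 ((1 + 4 * mu) * K) (fun y => f (X y)).
Proof.
  intros Hmu H H1 H2 y h. pose proof (C11_ge0 K f H) as HK.
  pose proof (Rabs_pos h) as Hh. pose proof (pow2_ge_0 h) as Hh2.
  assert (B : forall z, Rabs (f z) <= (1 + 4 * mu) * K).
  { intros z. pose proof (C11_bound K f z H). nra. }
  assert (KR : 0 <= K * Rabs h) by nra.
  repeat split; try apply B.
  - pose proof (C11_lip K f (X (y + h)) (X y) H). pose proof (H1 y h). nra.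
  - pose proof (C11_lip K f (X (y - h)) (X y) H). pose proof (H1 y (- h)) as H1'.
    rewrite Rabs_Ropp in H1'. replace (y + - h) with (y - h) in H1' by ring. nra.
  - eapply Rle_trans; [apply (C11_second K f _ _ _ H) |].
    pose proof (H2 y h) as H2'. pose proof (H1 y h) as H1'.
    assert (S : (X (y + h) - X y) ^ 2 <= (1 + mu) ^ 2 * h ^ 2).
    { rewrite <- Rpow_mult_distr, <- !Rsqr_pow2. apply Rsqr_le_abs_1.
      rewrite Rabs_mult, (Rabs_right (1 + mu)) by lra. exact H1'. }
    assert (S1 : K * (X (y + h) - X y) ^ 2 <= K * ((1 + mu) ^ 2 * h ^ 2))
      by (apply Rmult_le_compat_l; lra).
    assert (S2 : K * Rabs (X (y + h) - 2 * X y + X (y - h)) <= K * (mu * h ^ 2))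
      by (apply Rmult_le_compat_l; lra).
    assert (0 <= K * h ^ 2) by nra.
    assert (0 <= K * h ^ 2 * (mu * (1 - mu))) by (apply Rmult_le_pos; nra).
    nra.
Qed.

(** The factor 2 arises because the mean value points to the right and to the left of y may be 2|h|
    apart. *)
Lemma C11_of_derive (K : R) (f f1 f2 : R -> R) :
  (forall y, derivable_pt_lim f y (f1 y)) -> (forall y, derivable_pt_lim f1 y (f2 y)) ->
  (forall y, Rabs (f y) <= K) -> (forall y, Rabs (f1 y) <= K) ->
  (forall y, Rabs (f2 y) <= K) -> C11 (2 * K) f.
Proof.
  intros D1 D2 B0 B1 B2.
  assert (MV : forall g g' : R -> R, (forall y, derivable_pt_lim g y (g' y)) ->
     forall y z, exists x, Rabs (x - y) <= Rabs (z - y) /\ g z - g y = g' x * (z - y)).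
  { intros g g' D y z.
    destruct (MVT_gen g y z g') as (x & Hx & E).
    - intros x _. apply is_derive_Reals, D.
    - intros x _. apply derivable_continuous_pt. exists (g' x). apply D.
    - exists x. split; [|exact E]. unfold Rmin, Rmax in Hx.
      destruct (Rle_dec y z); unfold Rabs; repeat destruct Rcase_abs; lra. }
  assert (HK : 0 <= K) by (pose proof (B0 0); pose proof (Rabs_pos (f 0)); lra).
  assert (L : forall g g' : R -> R, (forall y, derivable_pt_lim g y (g' y)) ->
     (forall y, Rabs (g' y) <= K) -> forall y z, Rabs (g z - g y) <= K * Rabs (z - y)).
  { intros g g' D B y z. destruct (MV g g' D y z) as (x & _ & ->).
    rewrite Rabs_mult. apply Rmult_le_compat_r; [apply Rabs_pos | apply B]. }
  intros y h. pose proof (Rabs_pos h) as Hh.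
  assert (HKh : 0 <= K * Rabs h) by nra.
  repeat split; try (eapply Rle_trans; [apply B0 | lra]).
  - pose proof (L f f1 D1 B1 y (y + h)) as Q.
    replace (y + h - y) with h in Q by ring. lra.
  - pose proof (L f f1 D1 B1 y (y - h)) as Q.
    replace (y - h - y) with (- h) in Q by ring. rewrite Rabs_Ropp in Q. lra.
  - destruct (MV f f1 D1 y (y + h)) as (x & Hx & E).
    destruct (MV f f1 D1 y (y - h)) as (x' & Hx' & E').
    replace (y + h - y) with h in * by ring. replace (y - h - y) with (- h) in * by ring.
    rewrite Rabs_Ropp in Hx'.
    replace (f (y + h) - 2 * f y + f (y - h)) with ((f1 x - f1 x') * h) by lra.
    pose proof (L f1 f2 D2 B2 x' x) as Q.
    assert (Rabs (x - x') <= 2 * Rabs h).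
    { replace (x - x') with ((x - y) - (x' - y)) by ring.
      eapply Rle_trans; [apply Rabs_triang |]. rewrite Rabs_Ropp. lra. }
    rewrite Rabs_mult. rewrite <- (pow2_abs h). nra.
Qed.

(* Maximum principle: [f - chord - k/2 (x-a)(b-x)] with [k > K] has positive second
   differences, so it has no interior maximum. *)
Lemma chord_upper (K : R) (f : R -> R) (a b x : R) :
  (forall y, continuity_pt f y) ->
  (forall y h, - (K * h ^ 2) <= f (y + h) - 2 * f y + f (y - h)) ->
  a < b -> a <= x <= b ->
  f x - f a - (x - a) * ((f b - f a) / (b - a)) <= K / 2 * ((x - a) * (b - x)).
Proof.
  intros Hc H2 Hab Hx. set (s := (f b - f a) / (b - a)).
  assert (Hs : f b - f a = (b - a) * s) by (unfold s; field; lra).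
  assert (Hk : forall k, K < k -> f x - f a - (x - a) * s <= k / 2 * ((x - a) * (b - x))).
  { intros k Hk.
    set (phi := fun z => f z - f a - (z - a) * s - k / 2 * ((z - a) * (b - z))).
    assert (Cphi : forall z, a <= z <= b -> continuity_pt phi z).
    { intros z _. unfold phi. apply continuity_pt_minus.
      - apply (continuity_pt_minus (fun z => f z - f a) (fun z => (z - a) * s)).
        + apply continuity_pt_minus; [apply Hc | apply continuity_pt_const; congruence].
        + reg.
      - reg. }
    destruct (continuity_ab_maj phi a b (Rlt_le _ _ Hab) Cphi) as (m & Hm & Hmab).
    destruct (Rle_lt_dec (phi m) 0) as [Hle | Hgt].
    - pose proof (Hm x Hx). unfold phi in *. lra.
    - exfalso.
      assert (phi a = 0) by (unfold phi; ring).
      assert (phi b = 0) by (unfold phi; rewrite Hs; ring).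
      assert (a <> m) by (intros ->; lra). assert (b <> m) by (intros ->; lra).
      set (h := Rmin (m - a) (b - m)).
      assert (0 < h) by (unfold h; apply Rmin_glb_lt; lra).
      assert (h <= m - a) by apply Rmin_l. assert (h <= b - m) by apply Rmin_r.
      pose proof (Hm (m + h) ltac:(lra)) as M1. pose proof (Hm (m - h) ltac:(lra)) as M2.
      pose proof (H2 m h) as M3. unfold phi in M1, M2.
      assert (0 < (k - K) * h ^ 2) by (apply Rmult_lt_0_compat; [lra | apply pow_lt; lra]).
      nra. }
  (* Passage from every k > K to K itself: an excess g over the bound would survive the choice k = K
     + g/(P+1), which adds less than g. *)
  apply Rnot_lt_le. intros Hlt.
  set (P := (x - a) * (b - x)) in *. assert (HP : 0 <= P) by (unfold P; nra).
  set (g := f x - f a - (x - a) * s - K / 2 * P) in *.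
  assert (Hg : 0 < g) by (unfold g; lra).
  pose proof (Hk (K + g / (P + 1))) as Q.
  assert (0 < g / (P + 1)) by (apply Rdiv_lt_0_compat; lra).
  assert (g / (P + 1) * (P + 1) = g) by (field; lra).
  specialize (Q ltac:(lra)). unfold g in *. nra.
Qed.

Lemma C11_continuity (K : R) (f : R -> R) (y : R) : C11 K f -> continuity_pt f y.
Proof.
  intros H eps Heps. pose proof (C11_ge0 K f H) as HK.
  exists (eps / (K + 1)). split; [apply Rdiv_lt_0_compat; lra |].
  intros x (_ & Hx). simpl in *. unfold Rdist in *.
  pose proof (C11_lip K f x y H).
  assert (eps / (K + 1) * (K + 1) = eps) by (field; lra).
  pose proof (Rabs_pos (x - y)). nra.
Qed.

Lemma C11_chord (K : R) (f : R -> R) (a b x : R) :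
  C11 K f -> a < b -> a <= x <= b ->
  Rabs (f x - f a - (x - a) * ((f b - f a) / (b - a))) <= K / 2 * ((x - a) * (b - x)).
Proof.
  intros H Hab Hx. apply Rabs_le. split.
  - pose proof (chord_upper K (fun z => - f z) a b x) as Q.
    assert (E : (- f b - - f a) / (b - a) = - ((f b - f a) / (b - a))) by (field; lra).
    cbv beta in Q. rewrite E in Q.
    enough (- f x - - f a - (x - a) * - ((f b - f a) / (b - a))
            <= K / 2 * ((x - a) * (b - x))) by lra.
    apply Q; try assumption.
    + intros y. apply continuity_pt_opp, (C11_continuity K f y H).
    + intros y h. destruct (H y h) as (_ & _ & _ & _ & _ & F).
      apply Rabs_le_between in F. lra.
  - apply chord_upper; try assumption.
    + intros y. apply (C11_continuity K f y H).
    + intros y h. destruct (H y h) as (_ & _ & _ & _ & _ & F).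
      apply Rabs_le_between in F. lra.
Qed.

(** By the chord estimate the difference quotient q is Lipschitz in the step with constant K/2. So
    every q h - K h/2 lies below every q k + K k/2, and the supremum of the former is the right
    derivative. *)
Lemma C11_taylor_ex (K : R) (f : R -> R) (y : R) :
  C11 K f -> exists d, forall h, Rabs (f (y + h) - f y - d * h) <= 2 * K * h ^ 2.
Proof.
  intros H. pose proof (C11_ge0 K f H) as HK.
  set (q := fun h => (f (y + h) - f y) / h).
  assert (Hq : forall h k, 0 < h <= k -> Rabs (q h - q k) <= K / 2 * (k - h)).
  { intros h k Hhk. pose proof (C11_chord K f y (y + k) (y + h) H ltac:(lra) ltac:(lra)) as Q.
    replace (y + h - y) with h in Q by ring. replace (y + k - y) with k in Q by ring.
    replace (y + k - (y + h)) with (k - h) in Q by ring.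
    fold (q k) in Q.
    replace (f (y + h) - f y - h * q k) with (h * (q h - q k)) in Q
      by (unfold q; field; lra).
    rewrite Rabs_mult, (Rabs_right h) in Q by lra.
    apply Rmult_le_reg_l with h; lra. }
  assert (Hqq : forall h k, 0 < h -> 0 < k -> q h - K / 2 * h <= q k + K / 2 * k).
  { intros h k Hh Hk. destruct (Rle_dec h k) as [L | L].
    - pose proof (Hq h k ltac:(lra)) as Q. apply Rabs_le_between in Q. nra.
    - pose proof (Hq k h ltac:(lra)) as Q. apply Rabs_le_between in Q. nra. }
  destruct (completeness (fun r => exists h, 0 < h /\ r = q h - K / 2 * h)) as (d & Hub & Hlub).
  - exists (q 1 + K / 2 * 1). intros r (h & Hh & ->). apply Hqq; lra.
  - exists (q 1 - K / 2 * 1), 1. split; [lra | reflexivity].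
  - assert (Pos : forall h, 0 < h -> Rabs (f (y + h) - f y - d * h) <= K / 2 * h ^ 2).
    { intros h Hh.
      assert (q h - K / 2 * h <= d) by (apply Hub; exists h; split; [lra | reflexivity]).
      assert (d <= q h + K / 2 * h).
      { apply Hlub. intros r (k & Hk & ->). apply Hqq; lra. }
      replace (f (y + h) - f y - d * h) with (h * (q h - d)) by (unfold q; field; lra).
      rewrite Rabs_mult, (Rabs_right h) by lra.
      assert (Rabs (q h - d) <= K / 2 * h) by (apply Rabs_le; lra). nra. }
    exists d. intros h. destruct (total_order_T h 0) as [[Hn | ->] | Hp].
    (* A negative step is reflected to a positive one. The second difference adds K h^2 to the K/2
       h^2 already spent, within the allowed 2 K h^2. *)
    + pose proof (Pos (- h) ltac:(lra)) as Q.
      destruct (H y h) as (_ & _ & _ & _ & _ & F).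
      replace (y + - h) with (y - h) in Q by ring.
      replace (f (y + h) - f y - d * h)
        with ((f (y + h) - 2 * f y + f (y - h)) - (f (y - h) - f y - d * - h)) by ring.
      replace ((- h) ^ 2) with (h ^ 2) in Q by ring.
      pose proof (Rabs_minus_le _ _ _ _ F Q). pose proof (pow2_ge_0 h). nra.
    + replace (f (y + 0) - f y - d * 0) with 0 by (rewrite Rplus_0_r; ring).
      rewrite Rabs_R0. lra.
    + pose proof (Pos h ltac:(lra)). pose proof (pow2_ge_0 h). nra.
Qed.

Lemma C11_taylor (K : R) (f : R -> R) (y : R) :
  C11 K f ->
  derivable_pt_lim f y (Derive f y) /\
  forall h, Rabs (f (y + h) - f y - Derive f y * h) <= 2 * K * h ^ 2.
Proof.
  intros H. pose proof (C11_ge0 K f H) as HK.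
  destruct (C11_taylor_ex K f y H) as (d & Hd).
  assert (D : derivable_pt_lim f y d).
  { intros eps Heps.
    assert (Hp : 0 < eps / (2 * K + 1)) by (apply Rdiv_lt_0_compat; lra).
    exists (mkposreal _ Hp). simpl. intros h Hh Hlt.
    replace ((f (y + h) - f y) / h - d) with ((f (y + h) - f y - d * h) / h) by (field; lra).
    unfold Rdiv. rewrite Rabs_mult, Rabs_inv.
    assert (0 < Rabs h) by (apply Rabs_pos_lt; exact Hh).
    apply Rmult_lt_reg_r with (Rabs h); [lra |].
    rewrite Rmult_assoc, Rinv_l, Rmult_1_r by lra.
    specialize (Hd h). rewrite <- (pow2_abs h) in Hd.
    assert (eps / (2 * K + 1) * (2 * K + 1) = eps) by (field; lra).
    assert (Rabs h * (2 * K + 1) < eps) by nra.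
    nra. }
  assert (E : Derive f y = d) by (apply is_derive_unique, is_derive_Reals, D).
  rewrite E. split; assumption.
Qed.

Lemma C11_Derive_bound (K : R) (f : R -> R) (y : R) : C11 K f -> Rabs (Derive f y) <= K.
Proof.
  intros H. destruct (C11_taylor K f y H) as (_ & T).
  pose proof (C11_ge0 K f H) as HK.
  apply Rnot_lt_le. intros Hlt.
  set (g := Rabs (Derive f y) - K). assert (Hg : 0 < g) by (unfold g; lra).
  (* With this step the Taylor error per unit length, 2 K h, is smaller than the assumed excess
     g. *)
  set (h := g / (2 * K + 1)). assert (Hh : 0 < h) by (apply Rdiv_lt_0_compat; lra).
  assert (Eh : h * (2 * K + 1) = g) by (unfold h; field; lra).
  specialize (T h). pose proof (C11_lip K f (y + h) y H) as L.
  replace (y + h - y) with h in L by ring. rewrite (Rabs_right h) in L by lra.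
  assert (Q : Rabs (Derive f y * h) <= K * h + 2 * K * h ^ 2).
  { replace (Derive f y * h)
      with ((f (y + h) - f y) - (f (y + h) - f y - Derive f y * h)) by ring.
    apply Rabs_minus_le; assumption. }
  rewrite Rabs_mult, (Rabs_right h) in Q by lra.
  assert (Rabs (Derive f y) <= K + 2 * K * h) by nra.
  unfold g in *. nra.
Qed.

(** Adding the Taylor expansions from y to z and from z to y leaves the difference of the slopes
    times y - z, with an error 2 K (y - z)^2 from each. *)
Lemma C11_Derive_lip (K : R) (f : R -> R) (y z : R) :
  C11 K f -> Rabs (Derive f y - Derive f z) <= 4 * K * Rabs (y - z).
Proof.
  intros H. destruct (Req_dec y z) as [-> | Hne].
  - rewrite !Rminus_diag, Rabs_R0. lra.
  - destruct (C11_taylor K f y H) as (_ & T). destruct (C11_taylor K f z H) as (_ & T').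
    specialize (T (z - y)). specialize (T' (y - z)).
    replace (y + (z - y)) with z in T by ring. replace (z + (y - z)) with y in T' by ring.
    replace ((z - y) ^ 2) with ((y - z) ^ 2) in T by ring.
    pose proof (Rabs_plus_le _ _ _ _ T T') as Q.
    replace (f z - f y - Derive f y * (z - y) + (f y - f z - Derive f z * (y - z)))
      with ((Derive f y - Derive f z) * (y - z)) in Q by ring.
    rewrite Rabs_mult in Q. rewrite <- (pow2_abs (y - z)) in Q.
    assert (0 < Rabs (y - z)) by (apply Rabs_pos_lt; lra).
    apply Rmult_le_reg_r with (Rabs (y - z)); [lra | nra].
Qed.

(* The interpolation inequality |g'| <= |g|/k + k |g''| with [g = f1 - f2]. *)
Lemma C11_Derive_diff (K B k : R) (f1 f2 : R -> R) (y : R) :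
  C11 K f1 -> C11 K f2 -> (forall z, Rabs (f1 z - f2 z) <= B) -> 0 < k ->
  Rabs (Derive f1 y - Derive f2 y) <= 2 * B / k + 4 * K * k.
Proof.
  intros H1 H2 HB Hk.
  destruct (C11_taylor K f1 y H1) as (_ & T1). destruct (C11_taylor K f2 y H2) as (_ & T2).
  specialize (T1 k). specialize (T2 k).
  pose proof (Rabs_minus_le _ _ _ _ (Rabs_minus_le _ _ _ _ (HB (y + k)) (HB y))
                (Rabs_minus_le _ _ _ _ T1 T2)) as Q.
  match type of Q with Rabs ?x <= _ =>
    replace x with ((Derive f1 y - Derive f2 y) * k) in Q by ring end.
  rewrite Rabs_mult, (Rabs_right k) in Q by lra.
  apply Rmult_le_reg_r with k; [lra |].
  replace ((2 * B / k + 4 * K * k) * k) with (2 * B + 4 * K * k ^ 2) by (field; lra).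
  lra.
Qed.

(** * Limits of iterates and an abstract contraction principle *)

Lemma is_lim_seq_Rabs_le (u : nat -> R) (l B : R) :
  is_lim_seq u l -> (forall n, Rabs (u n) <= B) -> Rabs l <= B.
Proof.
  intros Hu HB. apply is_lim_seq_abs in Hu.
  exact (is_lim_seq_le _ _ _ _ HB Hu (is_lim_seq_const B)).
Qed.

Lemma tri_lim (e n K : R) (p q r : nat -> R) (p0 q0 r0 : R) :
  is_lim_seq p p0 -> is_lim_seq q q0 -> is_lim_seq r r0 ->
  (forall k, tri e n K (p k) (q k) (r k)) -> tri e n K p0 q0 r0.
Proof.
  intros Hp Hq Hr H.
  assert (H2 : is_lim_seq (fun k => p k - 2 * q k + r k) (p0 - 2 * q0 + r0)).
  { apply is_lim_seq_plus'; [apply is_lim_seq_minus' |]; try assumption.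
    apply (is_lim_seq_scal_l q 2 q0 Hq). }
  repeat split.
  - apply (is_lim_seq_Rabs_le p); [assumption | intros k; apply H].
  - apply (is_lim_seq_Rabs_le q); [assumption | intros k; apply H].
  - apply (is_lim_seq_Rabs_le r); [assumption | intros k; apply H].
  - apply (is_lim_seq_Rabs_le (fun k => p k - q k));
      [apply is_lim_seq_minus'; assumption | intros k; apply H].
  - apply (is_lim_seq_Rabs_le (fun k => r k - q k));
      [apply is_lim_seq_minus'; assumption | intros k; apply H].
  - apply (is_lim_seq_Rabs_le _ _ _ H2). intros k; apply H.
Qed.

Lemma geometric_cauchy_lim (u : nat -> R) (q C : R) :
  0 <= q < 1 -> (forall n, Rabs (u (S n) - u n) <= C * q ^ n) ->
  exists l : R, is_lim_seq u l /\ forall n, Rabs (u n - l) <= C * q ^ n / (1 - q).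
Proof.
  intros Hq Hu.
  assert (HC : 0 <= C).
  { pose proof (Hu 0%nat) as H0. simpl in H0. pose proof (Rabs_pos (u 1%nat - u 0%nat)). lra. }
  (* The exact partial sum of the geometric series is kept so that the induction closes. *)
  assert (Hd : forall n k, Rabs (u (n + k)%nat - u n) <= C * q ^ n / (1 - q) * (1 - q ^ k)).
  { intros n k. induction k as [|k IH].
    - rewrite Nat.add_0_r, Rminus_diag, Rabs_R0. simpl. lra.
    - rewrite Nat.add_succ_r.
      replace (u (S (n + k)) - u n)
        with ((u (S (n + k)) - u (n + k)%nat) + (u (n + k)%nat - u n)) by ring.
      eapply Rle_trans; [apply Rabs_plus_le; [apply Hu | apply IH] |].
      rewrite pow_add. simpl. right. field. lra. }
  assert (Hd' : forall n k, (n <= k)%nat -> Rabs (u k - u n) <= C * q ^ n / (1 - q)).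
  { intros n k Hnk. replace k with (n + (k - n))%nat by lia.
    eapply Rle_trans; [apply Hd |].
    assert (0 <= C * q ^ n / (1 - q)).
    { apply Rdiv_le_0_compat; [apply Rmult_le_pos; [lra | apply pow_le; lra] | lra]. }
    pose proof (pow_le q (k - n) ltac:(lra)). nra. }
  assert (Hz : is_lim_seq (fun n => C * q ^ n / (1 - q)) 0).
  { replace (Finite 0) with (Finite (C / (1 - q) * 0)) by (f_equal; ring).
    apply is_lim_seq_ext with (fun n => C / (1 - q) * q ^ n); [intros n; field; lra |].
    apply (is_lim_seq_scal_l (fun n => q ^ n) _ 0), is_lim_seq_geom.
    rewrite Rabs_right; lra. }
  assert (Hc : ex_finite_lim_seq u).
  { apply ex_lim_seq_cauchy_corr. intros eps.
    apply is_lim_seq_spec in Hz.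
    destruct (Hz (mkposreal (eps / 2) ltac:(destruct eps; simpl; lra))) as (N & HN).
    exists N. intros n m Hn Hm. specialize (HN N (Nat.le_refl N)). simpl in HN.
    rewrite Rminus_0_r in HN. apply Rabs_lt_between in HN.
    pose proof (Rabs_minus_le _ _ _ _ (Hd' N n Hn) (Hd' N m Hm)) as Q.
    replace (u n - u N - (u m - u N)) with (u n - u m) in Q by ring. lra. }
  destruct Hc as (l & Hl). exists l. split; [exact Hl |]. intros n.
  rewrite Rabs_minus_sym.
  apply (is_lim_seq_Rabs_le (fun k => u (k + n)%nat - u n)).
  - apply is_lim_seq_minus'; [apply -> is_lim_seq_incr_n; exact Hl | apply is_lim_seq_const].
  - intros k. apply Hd'. lia.
Qed.

(** Banach's principle for real functions on a bare index type. The weight [om] lets families of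
    different scale share one norm, and completeness reduces to closedness of [P] under pointwise
    limits. The iterates converge uniformly relative to [om], which is what permits comparing
    [F (zn n)] with [F z]. *)
Lemma weighted_contraction_fixed_point (I : Type) (om : I -> R) (P : (I -> R) -> Prop)
    (F : (I -> R) -> I -> R) (q e0 : R) (z0 : I -> R) :
  (forall i, 0 <= om i) -> 0 <= q < 1 -> 0 <= e0 ->
  P z0 -> (forall z, P z -> P (F z)) ->
  (forall z w e, P z -> P w -> 0 <= e -> (forall i, Rabs (z i - w i) <= e * om i) ->
     forall i, Rabs (F z i - F w i) <= q * e * om i) ->
  (forall i, Rabs (F z0 i - z0 i) <= e0 * om i) ->
  (forall (zn : nat -> I -> R) (z : I -> R), (forall n, P (zn n)) ->
     (forall i, is_lim_seq (fun n => zn n i) (z i)) -> P z) ->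
  exists z, P z /\ forall i, F z i = z i.
Proof.
  intros Hom Hq He0 P0 PF Hcontr Hstart Hclosed.
  set (zn := fix zn n := match n with O => z0 | S n => F (zn n) end).
  assert (Pn : forall n, P (zn n)) by (induction n; simpl; auto).
  assert (Step : forall n i, Rabs (zn (S n) i - zn n i) <= q ^ n * e0 * om i).
  { induction n as [|n IH]; intros i.
    - simpl. rewrite Rmult_1_l. apply Hstart.
    - eapply Rle_trans; [apply (Hcontr (zn (S n)) (zn n) (q ^ n * e0)); auto |].
      + apply Rmult_le_pos; [apply pow_le |]; lra.
      + simpl. right. ring. }
  set (z := fun i => real (Lim_seq (fun n => zn n i))).
  assert (Hz : forall i, is_lim_seq (fun n => zn n i) (z i) /\
            forall n, Rabs (zn n i - z i) <= e0 * om i * q ^ n / (1 - q)).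
  { intros i. destruct (geometric_cauchy_lim (fun n => zn n i) q (e0 * om i) Hq) as (l & Hl & B).
    - intros n. eapply Rle_trans; [apply Step | right; ring].
    - unfold z. rewrite (is_lim_seq_unique _ _ Hl). split; assumption. }
  assert (Pz : P z) by (apply (Hclosed zn); [exact Pn | intros i; apply Hz]).
  exists z. split; [exact Pz |]. intros i.
  assert (Lim2 : is_lim_seq (fun n => zn (S n) i) (F z i)).
  { apply is_lim_seq_ext with (fun n => F z i + (zn (S n) i - F z i)); [intros n; ring |].
    replace (Finite (F z i)) with (Finite (F z i + 0)) by (f_equal; ring).
    apply is_lim_seq_plus'; [apply is_lim_seq_const |].
    apply is_lim_seq_abs_0.
    apply is_lim_seq_le_le with (fun _ => 0) (fun n => q * (e0 / (1 - q)) * om i * q ^ n).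
    - intros n. split; [apply Rabs_pos |]. simpl.
      eapply Rle_trans; [apply (Hcontr (zn n) z (e0 / (1 - q) * q ^ n)); auto |].
      + apply Rmult_le_pos; [apply Rdiv_le_0_compat | apply pow_le]; lra.
      + intros j. eapply Rle_trans; [apply Hz |]. right. field. lra.
      + right. ring.
    - apply is_lim_seq_const.
    - replace (Finite 0) with (Finite (q * (e0 / (1 - q)) * om i * 0)) by (f_equal; ring).
      apply (is_lim_seq_scal_l (fun n => q ^ n) _ 0), is_lim_seq_geom.
      rewrite Rabs_right; lra. }
  destruct (Hz i) as (Lim1 & _). apply is_lim_seq_incr_1 in Lim1.
  apply is_lim_seq_unique in Lim1. apply is_lim_seq_unique in Lim2.
  rewrite Lim1 in Lim2. injection Lim2. congruence.
Qed.

(** * Integrals along characteristics *)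

(** Truncating time to [0, d] makes fields and characteristics available at all real times, so
    integrands are continuous on the whole line and integrals need no side conditions. *)
Definition clamp (d t : R) : R := Rmax 0 (Rmin t d).

Lemma clamp_bounds (d t : R) : 0 <= d -> 0 <= clamp d t <= d.
Proof. intros Hd. unfold clamp, Rmax, Rmin. repeat destruct Rle_dec; lra. Qed.

Lemma clamp_id (d t : R) : 0 <= t <= d -> clamp d t = t.
Proof. intros Ht. unfold clamp, Rmax, Rmin. repeat destruct Rle_dec; lra. Qed.

Lemma clamp_lip (d s t : R) : 0 <= d -> Rabs (clamp d s - clamp d t) <= Rabs (s - t).
Proof.
  intros Hd. unfold clamp, Rmax, Rmin.
  repeat destruct Rle_dec; unfold Rabs; repeat destruct Rcase_abs; lra.
Qed.

Lemma RInt_abs_le_const (f : R -> R) (a b M : R) :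
  (forall x, continuous f x) -> (forall x, Rmin a b <= x <= Rmax a b -> Rabs (f x) <= M) ->
  Rabs (RInt f a b) <= Rabs (b - a) * M.
Proof.
  intros Hc HM. apply (norm_RInt_le_const_abs f a b).
  - exact HM.
  - apply (RInt_correct (V := R_CompleteNormedModule)), ex_RInt_continuous. auto.
Qed.

Lemma RInt_sub (f g : R -> R) (a b : R) :
  (forall x, continuous f x) -> (forall x, continuous g x) ->
  RInt f a b - RInt g a b = RInt (fun x => f x - g x) a b.
Proof.
  intros Hf Hg. symmetry. apply (RInt_minus (V := R_CompleteNormedModule) f g);
  apply ex_RInt_continuous; auto.
Qed.

Lemma RInt_chain (f : R -> R) (a b c : R) :
  (forall x, continuous f x) -> RInt f a c = RInt f a b + RInt f b c.
Proof.
  intros Hf. symmetry. apply (RInt_Chasles (V := R_CompleteNormedModule) f);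
  apply ex_RInt_continuous; auto.
Qed.

(** Source of the factor 1/2 on which the contraction rests. *)
Lemma RInt_mean_linear (f : R -> R) (C t : R) :
  (forall x, continuous f x) -> 0 <= C -> 0 <= t ->
  (forall x, 0 <= x <= t -> Rabs (f x) <= x * C) -> Rabs (RInt f 0 t / t ^ 2) <= C / 2.
Proof.
  intros Hc HC Ht Hb. destruct (Req_dec t 0) as [-> | Hne].
  (* At t = 0 the integral vanishes, so the quotient is 0 whatever value the inverse of 0 has. *)
  - rewrite RInt_point. unfold zero; simpl. unfold Rdiv. rewrite Rmult_0_l, Rabs_R0. lra.
  - assert (Q : Rabs (RInt f 0 t) <= C * (t ^ 2 / 2)).
    { apply (norm_RInt_le f (fun x => x * C) 0 t).
      - exact Ht.
      - exact Hb.
      - apply (RInt_correct (V := R_CompleteNormedModule)), ex_RInt_continuous. auto.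
      - replace (C * (t ^ 2 / 2)) with (minus (C * (t ^ 2 / 2)) (C * (0 ^ 2 / 2)))
          by (unfold minus, plus, opp; simpl; field).
        apply (is_RInt_derive (fun x => C * (x ^ 2 / 2))).
        + intros x _. auto_derive; [exact I | field].
        + intros x _. apply continuity_pt_filterlim. reg. }
    assert (0 < t ^ 2) by (apply pow_lt; lra).
    unfold Rdiv. rewrite Rabs_mult, Rabs_inv, (Rabs_right (t ^ 2)) by lra.
    apply Rmult_le_reg_r with (t ^ 2); [lra |].
    rewrite Rmult_assoc, Rinv_l by lra. lra.
Qed.

Lemma tri_RInt_mean (f g h : R -> R) (e n C t : R) :
  (forall x, continuous f x) -> (forall x, continuous g x) -> (forall x, continuous h x) ->
  0 <= C -> 0 <= e -> 0 <= n -> 0 <= t ->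
  (forall x, 0 <= x <= t -> tri e n (x * C) (f x) (g x) (h x)) ->
  tri e n (C / 2) (RInt f 0 t / t ^ 2) (RInt g 0 t / t ^ 2) (RInt h 0 t / t ^ 2).
Proof.
  intros Hf Hg Hh HC He Hn Ht H.
  assert (Hsub : forall u v : R -> R, (forall x, continuous u x) -> (forall x, continuous v x) ->
            forall x, continuous (fun x => u x - v x) x).
  { intros u v Hu Hv x. apply (continuous_minus (V := R_NormedModule) u v); auto. }
  repeat split.
  - apply RInt_mean_linear; auto. intros x Hx. apply H, Hx.
  - apply RInt_mean_linear; auto. intros x Hx. apply H, Hx.
  - apply RInt_mean_linear; auto. intros x Hx. apply H, Hx.
  - unfold Rdiv at 1 2; rewrite <- Rmult_minus_distr_r, RInt_sub by auto.
    fold (Rdiv (RInt (fun x => f x - g x) 0 t) (t ^ 2)).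
    replace (C / 2 * e) with (C * e / 2) by field.
    apply RInt_mean_linear; auto; [nra |].
    intros x Hx. rewrite <- Rmult_assoc. apply H, Hx.
  - unfold Rdiv at 1 2; rewrite <- Rmult_minus_distr_r, RInt_sub by auto.
    fold (Rdiv (RInt (fun x => h x - g x) 0 t) (t ^ 2)).
    replace (C / 2 * e) with (C * e / 2) by field.
    apply RInt_mean_linear; auto; [nra |].
    intros x Hx. rewrite <- Rmult_assoc. apply H, Hx.
  - replace (RInt f 0 t / t ^ 2 - 2 * (RInt g 0 t / t ^ 2) + RInt h 0 t / t ^ 2)
      with (((RInt f 0 t - RInt g 0 t) - (RInt g 0 t - RInt h 0 t)) / t ^ 2)
      by (unfold Rdiv; ring).
    rewrite (RInt_sub f g), (RInt_sub g h), RInt_sub by auto.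
    replace (C / 2 * n) with (C * n / 2) by field.
    apply RInt_mean_linear; auto; [nra |].
    intros x Hx. rewrite <- Rmult_assoc.
    replace (f x - g x - (g x - h x)) with (f x - 2 * g x + h x) by ring.
    apply H, Hx.
Qed.

(* [q t y v] is a coefficient evaluated at [v = U / t ^ 2]; [C] bounds its C^{1,1} norm
   along admissible [v] and [L] is its Lipschitz constant in [v]. *)
Definition good_coef (d K C L : R) (q : R -> R -> (nat -> R) -> R) : Prop :=
  (forall t W, 0 < t <= d -> (forall j, C11 K (W j)) ->
     C11 C (fun y => q t y (fun j => W j y))) /\
  (forall t y v w e, 0 < t <= d -> (forall j, Rabs (v j) <= K) ->
     (forall j, Rabs (w j) <= K) -> (forall j, Rabs (v j - w j) <= e) ->
     Rabs (q t y v - q t y w) <= L * e) /\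
  (forall t y v, 0 < t <= d -> (forall j, Rabs (v j) <= K) ->
     continuity_pt (fun s => q s y v) t).

Definition fld (d : R) (q : R -> R -> (nat -> R) -> R) (V : nat -> R -> R -> R)
    (s y : R) : R :=
  clamp d s * q (clamp d s) y (fun j => V j s y).

(** [V] stands for U / t^2. Its value at truncated time 0 is arbitrary up to the bound [K]; the
    second clause is the Lipschitz continuity of U in time. *)
Definition admissible_V (d K : R) (V : nat -> R -> R -> R) : Prop :=
  (forall i t, C11 K (V i t)) /\
  (forall i t t' y, Rabs (clamp d t ^ 2 * V i t y - clamp d t' ^ 2 * V i t' y)
                    <= 3 * K * Rabs (t - t')).

Lemma C11_zero (f : R -> R) : (forall y, f y = 0) -> C11 0 f.
Proof.
  intros H y h. rewrite !H. pose proof (tri_const (Rabs h) (h ^ 2) 0) as T.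
  rewrite Rabs_R0 in T. apply T; [apply Rabs_pos | apply pow2_ge_0].
Qed.

Lemma C11_const (K k : R) : Rabs k <= K -> C11 K (fun _ => k).
Proof.
  intros H y h. pose proof (Rabs_pos h). pose proof (pow2_ge_0 h).
  apply tri_weaken with (Rabs k); try assumption. apply tri_const; assumption.
Qed.

Lemma C11_scal (K k : R) (f : R -> R) : 0 <= k -> C11 K f -> C11 (k * K) (fun y => k * f y).
Proof.
  intros Hk H y h. rewrite <- (Rabs_right k) at 1 by lra. apply tri_scal, H.
Qed.

Lemma fld_C11 (d K C L : R) q V (s : R) :
  0 < d -> good_coef d K C L q -> admissible_V d K V -> C11 (clamp d s * C) (fld d q V s).
Proof.
  intros Hd (H1 & _) (HV & _). pose proof (clamp_bounds d s (Rlt_le _ _ Hd)) as Hs.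
  destruct (Req_dec (clamp d s) 0) as [E | E].
  - rewrite E, Rmult_0_l. apply C11_zero. intros y. unfold fld. rewrite E. ring.
  - apply (C11_scal C (clamp d s)); [lra |].
    apply (H1 (clamp d s) (fun j => V j s)); [lra | intros j; apply HV].
Qed.

Lemma good_coef_ge0 (d K C L : R) q : 0 < d -> 0 <= K -> good_coef d K C L q -> 0 <= C.
Proof.
  intros Hd HK (H & _).
  apply (C11_ge0 _ _ (H d (fun _ _ => 0) ltac:(lra)
    ltac:(intros j; apply (C11_const K 0); rewrite Rabs_R0; exact HK))).
Qed.

Lemma fld_lip_V (d K C L e : R) q V V' (s y : R) :
  0 < d -> good_coef d K C L q -> admissible_V d K V -> admissible_V d K V' ->
  (forall j, Rabs (V j s y - V' j s y) <= e) ->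
  Rabs (fld d q V s y - fld d q V' s y) <= clamp d s * (L * e).
Proof.
  intros Hd (_ & H2 & _) (HV & _) (HV' & _) He.
  pose proof (clamp_bounds d s (Rlt_le _ _ Hd)) as Hs.
  destruct (Req_dec (clamp d s) 0) as [E | E].
  - unfold fld. rewrite E, !Rmult_0_l, Rminus_diag, Rabs_R0. lra.
  - unfold fld. rewrite <- Rmult_minus_distr_l, Rabs_mult, (Rabs_right (clamp d s)) by lra.
    apply Rmult_le_compat_l; [lra |].
    apply H2; [lra | | | exact He]; intros j; eapply C11_bound; auto.
Qed.

Lemma fld_cont (d K C L : R) q V (s y eps : R) :
  0 < d -> 0 <= L -> good_coef d K C L q -> admissible_V d K V -> 0 < eps ->
  exists del, 0 < del /\ forall s' y', Rabs (s' - s) < del -> Rabs (y' - y) < del ->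
    Rabs (fld d q V s' y' - fld d q V s y) < eps.
Proof.
  intros Hd HL Hq HV Heps.
  assert (HK : 0 <= K) by (apply (C11_ge0 _ _ (proj1 HV 0%nat 0))).
  pose proof (good_coef_ge0 d K C L q Hd HK Hq) as HC.
  pose proof (clamp_bounds d s (Rlt_le _ _ Hd)) as Hs.
  set (tau := clamp d s) in *.
  destruct (Req_dec tau 0) as [E | E].
  (* At truncated time 0 boundedness of the coefficient is enough, since the prefactor [clamp d s']
     is at most |s' - s|. *)
  - exists (eps / (C + 1)). split; [apply Rdiv_lt_0_compat; lra |]. intros s' y' Hs' _.
    unfold fld at 2. fold tau. rewrite E, Rmult_0_l, Rminus_0_r.
    eapply Rle_lt_trans; [apply (C11_bound _ _ y' (fld_C11 d K C L q V s' Hd Hq HV)) |].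
    pose proof (clamp_lip d s' s (Rlt_le _ _ Hd)) as Hl. fold tau in Hl. rewrite E in Hl.
    rewrite Rminus_0_r, Rabs_right in Hl
      by (apply Rle_ge, clamp_bounds; lra).
    assert (eps / (C + 1) * (C + 1) = eps) by (field; lra). nra.
  - destruct Hq as (Q1 & Q2 & Q3). destruct HV as (V1 & V2).
    set (v := fun j => V j s y).
    assert (Hv : forall j, Rabs (v j) <= K) by (intros j; apply (C11_bound K (V j s)), V1).
    (* Rate of variation of V near (s, y): K from the y-direction; in time, the increment of tau^2 V
       gives 3K and the change of the factor tau^2 gives 2dK, both divided by tau^2 > 0. *)
    set (c := K + (3 + 2 * d) * K / tau ^ 2).
    assert (Ht2 : 0 < tau ^ 2) by (apply pow_lt; lra).
    assert (Hc : 0 <= c).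
    { unfold c. apply Rplus_le_le_0_compat; [lra |].
      apply Rdiv_le_0_compat; [apply Rmult_le_pos; lra | lra]. }
    set (e1 := eps / (4 * (d + 1))).
    assert (He1 : 0 < e1) by (apply Rdiv_lt_0_compat; lra).
    assert (Ee1 : e1 * (4 * (d + 1)) = eps) by (unfold e1; field; lra).
    destruct (Q3 tau y v ltac:(lra) Hv e1 He1) as (al & Hal & Hcont).
    set (m := L * c + C + 1).
    assert (Hm : 0 < m) by (unfold m; pose proof (Rmult_le_pos _ _ HL Hc); lra).
    exists (Rmin (Rmin tau al) (e1 / m)).
    assert (He1m : 0 < e1 / m) by (apply Rdiv_lt_0_compat; lra).
    split; [repeat apply Rmin_glb_lt; lra |].
    intros s' y' Hs' Hy'.
    pose proof (Rmin_l (Rmin tau al) (e1 / m)). pose proof (Rmin_r (Rmin tau al) (e1 / m)).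
    pose proof (Rmin_l tau al). pose proof (Rmin_r tau al).
    set (del := e1 / m) in *. assert (Edel : del * m = e1) by (unfold del; field; lra).
    pose proof (clamp_bounds d s' (Rlt_le _ _ Hd)) as Hb.
    pose proof (clamp_lip d s' s (Rlt_le _ _ Hd)) as Hl. fold tau in Hl.
    unfold fld. fold tau. set (tau' := clamp d s') in *.
    assert (Hpos : 0 < tau').
    { assert (X : Rabs (tau' - tau) < tau) by lra. apply Rabs_lt_between in X. lra. }
    fold v. set (v' := fun j => V j s' y').
    assert (Hv' : forall j, Rabs (v' j) <= K) by (intros j; apply (C11_bound K (V j s')), V1).
    assert (Dv : forall j, Rabs (v' j - v j) <= c * del).
    { intros j. unfold v', v.
      replace (V j s' y' - V j s y)
        with ((V j s' y' - V j s' y) +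
              ((tau' ^ 2 * V j s' y - tau ^ 2 * V j s y)
               + (tau - tau') * ((tau + tau') * V j s' y)) / tau ^ 2) by (field; lra).
      replace (c * del) with (K * del + (3 * K * del + del * (2 * d * K)) / tau ^ 2)
        by (unfold c; field; lra).
      apply Rabs_plus_le.
      - eapply Rle_trans; [apply (C11_lip K (V j s')), V1 |]. apply Rmult_le_compat_l; lra.
      - unfold Rdiv. rewrite Rabs_mult, Rabs_inv, (Rabs_right (tau ^ 2)) by lra.
        apply Rmult_le_compat_r; [apply Rlt_le, Rinv_0_lt_compat; lra |].
        apply Rabs_plus_le.
        + eapply Rle_trans; [apply V2 |]. apply Rmult_le_compat_l; lra.
        + apply Rabs_mult_le; [rewrite Rabs_minus_sym; lra |].
          apply Rabs_mult_le; [rewrite Rabs_right; lra | apply (C11_bound K (V j s')), V1]. }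
    assert (D1 : Rabs (q tau' y' v' - q tau' y' v) <= L * (c * del)) by (apply Q2; auto; lra).
    assert (CW : C11 C (fun y => q tau' y v)).
    { apply (Q1 tau' (fun j _ => v j)); [lra |]. intros j. apply (C11_const K (v j)), Hv. }
    assert (D2 : Rabs (q tau' y' v - q tau' y v) <= C * del).
    { eapply Rle_trans; [apply (C11_lip C _ y' y CW) |]. apply Rmult_le_compat_l; lra. }
    assert (D3 : Rabs (q tau' y v - q tau y v) <= e1).
    { destruct (Req_dec tau tau') as [-> | Hne]; [rewrite Rminus_diag, Rabs_R0; lra |].
      apply Rlt_le, (Hcont tau'). split; [split; [exact I | exact Hne] |].
      simpl. unfold Rdist. lra. }
    assert (D4 : Rabs (q tau y v) <= C).
    { apply (C11_bound C (fun y => q tau y v)).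
      apply (Q1 tau (fun j _ => v j)); [lra |]. intros j. apply (C11_const K (v j)), Hv. }
    replace (tau' * q tau' y' v' - tau * q tau y v)
      with (tau' * ((q tau' y' v' - q tau' y' v) + (q tau' y' v - q tau' y v)
                    + (q tau' y v - q tau y v)) + (tau' - tau) * q tau y v) by ring.
    assert (Hfin : Rabs (tau' * ((q tau' y' v' - q tau' y' v) + (q tau' y' v - q tau' y v)
                    + (q tau' y v - q tau y v)) + (tau' - tau) * q tau y v)
             <= d * (L * (c * del) + C * del + e1) + del * C).
    { apply Rabs_plus_le; apply Rabs_mult_le; try assumption.
      - rewrite Rabs_right; lra.
      - repeat apply Rabs_plus_le; assumption.
      - lra. }
    assert (0 <= C * del) by nra.
    assert (0 <= L * (c * del)) by (pose proof (Rmult_le_pos _ _ HL Hc); nra).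
    assert (L * (c * del) + C * del + del = e1) by (unfold m in Edel; lra).
    assert (0 < del) by lra.
    nra.
Qed.

Lemma fld_path_continuous (d K C L : R) q V (xi : R -> R) (s : R) :
  0 < d -> 0 <= L -> good_coef d K C L q -> admissible_V d K V ->
  (forall s s', Rabs (xi s - xi s') <= Rabs (s - s')) ->
  continuous (fun s => fld d q V s (xi s)) s.
Proof.
  intros Hd HL Hq HV Hxi. apply continuity_pt_filterlim. intros eps Heps.
  destruct (fld_cont d K C L q V s (xi s) eps Hd HL Hq HV Heps) as (del & Hdel & H).
  exists del. split; [exact Hdel |]. intros s' (_ & Hs'). simpl in *. unfold Rdist in *.
  apply H; [exact Hs' |]. eapply Rle_lt_trans; [apply Hxi | exact Hs'].
Qed.

(** * The fixed point *)

(* [X i s t y] is the position at time [s] of the [i]-th characteristic through [(t, y)]. *)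
Definition admissible_X (X : nat -> R -> R -> R -> R) : Prop :=
  (forall i s s' t y, Rabs (X i s t y - X i s' t y) <= Rabs (s - s')) /\
  (forall i s t t' y, Rabs (X i s t y - X i s t' y) <= Rabs (t - t')) /\
  (forall i s t y h, Rabs (X i s t (y + h) - X i s t y) <= (1 + / 32) * Rabs h) /\
  (forall i s t y h, Rabs (X i s t (y + h) - 2 * X i s t y + X i s t (y - h))
                     <= / 32 * h ^ 2).

Definition next_X (d : R) l (X : nat -> R -> R -> R -> R) V (i : nat) (s t y : R) : R :=
  y - RInt (fun r => fld d (l i) V r (X i r t y)) (clamp d s) (clamp d t).

Definition next_V (d : R) p (X : nat -> R -> R -> R -> R) V (i : nat) (t y : R) : R :=
  RInt (fun r => fld d (p i) V r (X i r t y)) 0 (clamp d t) / clamp d t ^ 2.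

(** In [1 + 8 * K] the 1 is the weight of the characteristics and 8K the weight of [V] in the
    contraction norm. The source is controlled relative to [K], whereas the speeds may have any
    bound [C] that is beaten by a short time. *)
Definition small_system (d K C : R) (p l : nat -> R -> R -> (nat -> R) -> R) : Prop :=
  0 < d <= 1 /\ 0 < K /\ 0 <= C /\ d * C * (1 + 8 * K) <= / 64 /\
  (forall i, good_coef d K (5 / 4 * K) (5 / 4) (p i)) /\
  (forall i, good_coef d K C C (l i)).

Lemma fld_bound (d K C L : R) q V (s y : R) :
  0 < d -> good_coef d K C L q -> admissible_V d K V -> Rabs (fld d q V s y) <= d * C.
Proof.
  intros Hd Hq HV.
  pose proof (good_coef_ge0 d K C L q Hd (C11_ge0 _ _ (proj1 HV 0%nat 0)) Hq).
  pose proof (clamp_bounds d s (Rlt_le _ _ Hd)).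
  pose proof (C11_bound _ _ y (fld_C11 d K C L q V s Hd Hq HV)). nra.
Qed.

Lemma fld_lip (d K C L : R) q V (s y z : R) :
  0 < d -> good_coef d K C L q -> admissible_V d K V ->
  Rabs (fld d q V s y - fld d q V s z) <= d * C * Rabs (y - z).
Proof.
  intros Hd Hq HV.
  pose proof (good_coef_ge0 d K C L q Hd (C11_ge0 _ _ (proj1 HV 0%nat 0)) Hq).
  pose proof (clamp_bounds d s (Rlt_le _ _ Hd)).
  eapply Rle_trans; [apply (C11_lip _ _ _ _ (fld_C11 d K C L q V s Hd Hq HV)) |].
  apply Rmult_le_compat_r; [apply Rabs_pos | nra].
Qed.

Lemma fld_along_C11 (d K C L : R) q V X (i : nat) (s t : R) :
  0 < d -> good_coef d K C L q -> admissible_V d K V -> admissible_X X ->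
  C11 (clamp d s * (9 / 8 * C)) (fun y => fld d q V s (X i s t y)).
Proof.
  intros Hd Hq HV (_ & _ & X3 & X4).
  replace (clamp d s * (9 / 8 * C)) with ((1 + 4 * / 32) * (clamp d s * C)) by field.
  apply (C11_comp (clamp d s * C) (/ 32)); [lra | | apply X3 | apply X4].
  apply (fld_C11 d K C L); assumption.
Qed.

Lemma fld_along_continuous (d K C L : R) q V X (i : nat) (t y s : R) :
  0 < d -> 0 <= L -> good_coef d K C L q -> admissible_V d K V -> admissible_X X ->
  continuous (fun r => fld d q V r (X i r t y)) s.
Proof.
  intros Hd HL Hq HV (X1 & _). apply (fld_path_continuous d K C L); try assumption.
  intros r r'. apply X1.
Qed.

Lemma clamp_RInt_bound (d M s t : R) (f : R -> R) :
  0 <= d -> 0 <= M -> (forall x, continuous f x) -> (forall x, Rabs (f x) <= M) ->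
  Rabs (RInt f (clamp d s) (clamp d t)) <= Rabs (s - t) * M /\
  Rabs (RInt f (clamp d s) (clamp d t)) <= d * M.
Proof.
  intros Hd HM Hc HB.
  assert (Q : Rabs (RInt f (clamp d s) (clamp d t)) <= Rabs (clamp d t - clamp d s) * M)
    by (apply RInt_abs_le_const; auto).
  split; (eapply Rle_trans; [exact Q | apply Rmult_le_compat_r; [exact HM |]]).
  - rewrite (Rabs_minus_sym s). apply clamp_lip, Hd.
  - pose proof (clamp_bounds d s Hd). pose proof (clamp_bounds d t Hd).
    apply Rabs_le. lra.
Qed.

Lemma continuous_sub (f g : R -> R) (x : R) :
  continuous f x -> continuous g x -> continuous (fun r => f r - g r) x.
Proof. intros Hf Hg. apply (continuous_minus (V := R_NormedModule) f g); assumption. Qed.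

Lemma next_X_admissible (d K C : R) p l X V :
  small_system d K C p l -> admissible_X X -> admissible_V d K V ->
  admissible_X (next_X d l X V).
Proof.
  intros (Hd & HK & HC & Hs & _ & Hl) HX HV.
  assert (Hd0 : 0 < d) by lra. assert (Hd1 : 0 <= d) by lra.
  assert (HdC : d * C <= / 64) by nra. assert (HdC0 : 0 <= d * C) by nra.
  assert (Cont : forall i t y x, continuous (fun r => fld d (l i) V r (X i r t y)) x).
  { intros i t y x. apply (fld_along_continuous d K C C); auto. }
  assert (B : forall i t y x, Rabs (fld d (l i) V x (X i x t y)) <= d * C).
  { intros i t y x. apply (fld_bound d K C C); auto. }
  (* Since d C <= 1/64, the composed field has constant at most 9/512 < 1/32, which reproduces the
     constant of [admissible_X]. *)
  assert (A : forall i t, forall r,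
     C11 (/ 32) (fun y => fld d (l i) V r (X i r t y))).
  { intros i t r y h. apply tri_weaken with (clamp d r * (9 / 8 * C)).
    - apply Rabs_pos. - apply pow2_ge_0.
    - pose proof (clamp_bounds d r Hd1). nra.
    - apply (fld_along_C11 d K C C); auto. }
  unfold next_X. repeat split.
  - intros i s s' t y. pose proof (Rabs_pos (s - s')).
    rewrite (RInt_chain _ (clamp d s) (clamp d s')) by apply Cont.
    destruct (clamp_RInt_bound d (d * C) s s' (fun r : R => fld d (l i) V r (X i r t y))
                Hd1 HdC0 (Cont i t y) (B i t y)) as (Q & _).
    match goal with |- Rabs ?x <= _ => match type of Q with Rabs ?w <= _ =>
      replace x with (- w) by ring end end.
    rewrite Rabs_Ropp. nra.
  - intros i s t t' y. pose proof (Rabs_pos (t - t')).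
    rewrite (RInt_chain _ (clamp d s) (clamp d t')) by apply Cont.
    destruct (clamp_RInt_bound d (d * C) t' t (fun r : R => fld d (l i) V r (X i r t y))
                Hd1 HdC0 (Cont i t y) (B i t y)) as (Q & _).
    (* The final time enters twice: through the end of the integration interval and through the path
       under the integral. *)
    match goal with |- Rabs (y - (?u + ?v) - (y - ?w)) <= _ =>
      replace (y - (u + v) - (y - w)) with ((w - u) - v) by ring end.
    rewrite RInt_sub by apply Cont.
    destruct (clamp_RInt_bound d (d * C * Rabs (t - t')) s t'
       (fun x => fld d (l i) V x (X i x t' y) - fld d (l i) V x (X i x t y)) Hd1)
      as (_ & Q').
    + nra.
    + intros x. apply continuous_sub; apply Cont.
    + intros x. eapply Rle_trans; [apply (fld_lip d K C C); auto |].
      apply Rmult_le_compat_l; [lra |]. rewrite (Rabs_minus_sym t). apply HX.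
    + rewrite (Rabs_minus_sym t' t) in Q.
      eapply Rle_trans; [apply Rabs_minus_le; [exact Q' | exact Q] |].
      assert (0 <= d * C * Rabs (t - t')) by nra. nra.
  - intros i s t y h. pose proof (Rabs_pos h).
    match goal with |- Rabs (y + h - ?u - (y - ?v)) <= _ =>
      replace (y + h - u - (y - v)) with (h - (u - v)) by ring end.
    rewrite RInt_sub by apply Cont.
    destruct (clamp_RInt_bound d (/ 32 * Rabs h) s t
      (fun x => fld d (l i) V x (X i x t (y + h)) - fld d (l i) V x (X i x t y)) Hd1)
      as (_ & Q).
    + nra.
    + intros x. apply continuous_sub; apply Cont.
    + intros x. apply (A i t x y h).
    + eapply Rle_trans; [apply Rabs_minus_le; [apply Rle_refl | exact Q] |]. nra.
  - intros i s t y h. pose proof (pow2_ge_0 h).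
    match goal with |- Rabs (y + h - ?u - 2 * (y - ?v) + (y - h - ?w)) <= _ =>
      replace (y + h - u - 2 * (y - v) + (y - h - w)) with (- ((u - v) - (v - w))) by ring end.
    rewrite Rabs_Ropp, 2!RInt_sub by apply Cont.
    rewrite RInt_sub by (intros x; apply continuous_sub; apply Cont).
    destruct (clamp_RInt_bound d (/ 32 * h ^ 2) s t
      (fun x => fld d (l i) V x (X i x t (y + h)) - fld d (l i) V x (X i x t y)
       - (fld d (l i) V x (X i x t y) - fld d (l i) V x (X i x t (y - h)))) Hd1)
      as (_ & Q).
    + nra.
    + intros x. apply continuous_sub; apply continuous_sub; apply Cont.
    + intros x. destruct (A i t x y h) as (_ & _ & _ & _ & _ & F).
      match goal with |- Rabs ?u <= _ => match type of F with Rabs ?w <= _ =>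
        replace u with w by ring end end. exact F.
    + nra.
Qed.

Lemma next_V_clamp (d : R) p X V i t y :
  clamp d t ^ 2 * next_V d p X V i t y
  = RInt (fun r => fld d (p i) V r (X i r t y)) 0 (clamp d t).
Proof.
  unfold next_V. destruct (Req_dec (clamp d t) 0) as [E | E].
  - rewrite E, RInt_point. unfold zero; simpl. ring.
  - field. exact E.
Qed.

Lemma clamp_0 (d : R) : 0 <= d -> clamp d 0 = 0.
Proof. intros Hd. apply clamp_id; lra. Qed.

(** The y-bounds return with the factor 45/64. In time, the moving endpoint and the moving path
    contribute at most 5/4 K each, which stays below 3K. *)
Lemma next_V_admissible (d K C : R) p l X V :
  small_system d K C p l -> admissible_X X -> admissible_V d K V ->
  admissible_V d K (next_V d p X V).
Proof.
  intros (Hd & HK & HC & Hs & Hp & _) HX HV.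
  assert (Hd0 : 0 < d) by lra. assert (Hd1 : 0 <= d) by lra.
  assert (Cont : forall i t y x, continuous (fun r => fld d (p i) V r (X i r t y)) x).
  { intros i t y x. apply (fld_along_continuous d K (5 / 4 * K) (5 / 4)); auto; lra. }
  split.
  - intros i t y h. unfold next_V. pose proof (clamp_bounds d t Hd1) as Ht.
    pose proof (Rabs_pos h) as Hh. pose proof (pow2_ge_0 h) as Hh2.
    apply tri_weaken with (9 / 8 * (5 / 4 * K) / 2); [assumption | assumption | lra |].
    apply tri_RInt_mean; try apply Cont; try assumption; try lra.
    intros x Hx. rewrite <- (clamp_id d x) at 1 by lra.
    apply (fld_along_C11 d K (5 / 4 * K) (5 / 4)); auto.
  - intros i t t' y. rewrite !next_V_clamp. pose proof (Rabs_pos (t - t')).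
    rewrite (RInt_chain (fun r => fld d (p i) V r (X i r t y)) 0 (clamp d t')) by apply Cont.
    match goal with |- Rabs (?u + ?v - ?w) <= _ =>
      replace (u + v - w) with (v + (u - w)) by ring end.
    rewrite RInt_sub by apply Cont.
    destruct (clamp_RInt_bound d (d * (5 / 4 * K)) t' t
       (fun r => fld d (p i) V r (X i r t y)) Hd1) as (Q & _).
    + nra.
    + apply Cont.
    + intros x. apply (fld_bound d K (5 / 4 * K) (5 / 4)); auto.
    + destruct (clamp_RInt_bound d (d * (5 / 4 * K) * Rabs (t - t')) 0 t'
        (fun x => fld d (p i) V x (X i x t y) - fld d (p i) V x (X i x t' y)) Hd1)
        as (_ & Q').
      * apply Rmult_le_pos; nra.
      * intros x. apply continuous_sub; apply Cont.
      * intros x. eapply Rle_trans; [apply (fld_lip d K (5 / 4 * K) (5 / 4)); auto |].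
        apply Rmult_le_compat_l; [nra |]. apply HX.
      * rewrite clamp_0 in Q' by lra. rewrite (Rabs_minus_sym t' t) in Q.
        eapply Rle_trans; [apply Rabs_plus_le; [exact Q | exact Q'] |].
        assert (0 <= K * Rabs (t - t')) by nra.
        assert (d * (K * Rabs (t - t')) <= K * Rabs (t - t')) by nra.
        nra.
Qed.

(** A displaced path costs d C e and a changed [V] costs d C (8 K e), so the smallness of d C (1 + 8
    K) suffices. *)
Lemma next_X_contracts (d K C e : R) p l X V X' V' :
  small_system d K C p l -> admissible_X X -> admissible_V d K V ->
  admissible_X X' -> admissible_V d K V' -> 0 <= e ->
  (forall i s t y, Rabs (X i s t y - X' i s t y) <= e) ->
  (forall i t y, Rabs (V i t y - V' i t y) <= 8 * K * e) ->
  forall i s t y, Rabs (next_X d l X V i s t y - next_X d l X' V' i s t y) <= 3 / 4 * e.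
Proof.
  intros (Hd & HK & HC & Hs & _ & Hl) HX HV HX' HV' He DX DV i s t y.
  assert (Hd0 : 0 < d) by lra. assert (Hd1 : 0 <= d) by lra.
  assert (Cont : forall x, continuous (fun r => fld d (l i) V r (X i r t y)) x).
  { intros x. apply (fld_along_continuous d K C C); auto. }
  assert (Cont' : forall x, continuous (fun r => fld d (l i) V' r (X' i r t y)) x).
  { intros x. apply (fld_along_continuous d K C C); auto. }
  unfold next_X.
  match goal with |- Rabs (y - ?u - (y - ?v)) <= _ =>
    replace (y - u - (y - v)) with (v - u) by ring end.
  rewrite RInt_sub by assumption.
  destruct (clamp_RInt_bound d (d * C * e + d * (C * (8 * K * e))) s t
    (fun x => fld d (l i) V' x (X' i x t y) - fld d (l i) V x (X i x t y)) Hd1)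
    as (_ & Q).
  - assert (0 <= d * C) by nra. assert (0 <= 8 * K * e) by nra.
    assert (0 <= C * (8 * K * e)) by nra. nra.
  - intros x. apply continuous_sub; auto.
  - intros x. rewrite Rabs_minus_sym.
    replace (fld d (l i) V x (X i x t y) - fld d (l i) V' x (X' i x t y)) with
      ((fld d (l i) V x (X i x t y) - fld d (l i) V x (X' i x t y))
       + (fld d (l i) V x (X' i x t y) - fld d (l i) V' x (X' i x t y))) by ring.
    apply Rabs_plus_le.
    + eapply Rle_trans; [apply (fld_lip d K C C); auto |].
      apply Rmult_le_compat_l; [nra | apply DX].
    + eapply Rle_trans; [apply (fld_lip_V d K C C (8 * K * e)); auto |].
      apply Rmult_le_compat_r; [| apply clamp_bounds, Hd1].
      apply Rmult_le_pos; [lra | nra].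
  - eapply Rle_trans; [exact Q |].
    replace (d * (d * C * e + d * (C * (8 * K * e)))) with (d * (d * C * (1 + 8 * K)) * e) by ring.
    assert (0 <= d * C * (1 + 8 * K)) by (apply Rmult_le_pos; nra).
    assert (d * (d * C * (1 + 8 * K)) <= 3 / 4) by nra. nra.
Qed.

(** This estimate fixes the weight 8K. Displaced paths contribute (5/4 K e)/2 and the change of [V]
    contributes (5/4)(8 K e)/2, in total 45/8 K e <= 6 K e; with a weight much smaller than 8K the
    first part would not be absorbed. *)
Lemma next_V_contracts (d K C e : R) p l X V X' V' :
  small_system d K C p l -> admissible_X X -> admissible_V d K V ->
  admissible_X X' -> admissible_V d K V' -> 0 <= e ->
  (forall i s t y, Rabs (X i s t y - X' i s t y) <= e) ->
  (forall i t y, Rabs (V i t y - V' i t y) <= 8 * K * e) ->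
  forall i t y, Rabs (next_V d p X V i t y - next_V d p X' V' i t y) <= 3 / 4 * (8 * K * e).
Proof.
  intros (Hd & HK & HC & Hs & Hp & _) HX HV HX' HV' He DX DV i t y.
  assert (Hd0 : 0 < d) by lra. assert (Hd1 : 0 <= d) by lra.
  assert (Cont : forall x, continuous (fun r => fld d (p i) V r (X i r t y)) x).
  { intros x. apply (fld_along_continuous d K (5 / 4 * K) (5 / 4)); auto; lra. }
  assert (Cont' : forall x, continuous (fun r => fld d (p i) V' r (X' i r t y)) x).
  { intros x. apply (fld_along_continuous d K (5 / 4 * K) (5 / 4)); auto; lra. }
  assert (HKe : 0 <= K * e) by nra.
  unfold next_V. pose proof (clamp_bounds d t Hd1) as Ht.
  unfold Rdiv at 1 2. rewrite <- Rmult_minus_distr_r, RInt_sub by assumption.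
  eapply Rle_trans;
    [apply (RInt_mean_linear _ (5 / 4 * K * e + 5 / 4 * (8 * K * e))) |].
  - intros x. apply continuous_sub; auto.
  - lra.
  - apply Ht.
  - intros x Hx.
    replace (fld d (p i) V x (X i x t y) - fld d (p i) V' x (X' i x t y)) with
      ((fld d (p i) V x (X i x t y) - fld d (p i) V x (X' i x t y))
       + (fld d (p i) V x (X' i x t y) - fld d (p i) V' x (X' i x t y))) by ring.
    assert (Ex : clamp d x = x) by (apply clamp_id; lra).
    rewrite Rmult_plus_distr_l. apply Rabs_plus_le.
    + eapply Rle_trans;
        [apply (C11_lip _ _ _ _ (fld_C11 d K (5 / 4 * K) (5 / 4) (p i) V x Hd0 (Hp i) HV)) |].
      rewrite Ex. replace (x * (5 / 4 * K * e)) with (x * (5 / 4 * K) * e) by ring.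
      apply Rmult_le_compat_l; [apply Rmult_le_pos; lra | apply DX].
    + pose proof (fld_lip_V d K (5 / 4 * K) (5 / 4) (8 * K * e) (p i) V V' x (X' i x t y)
                    Hd0 (Hp i) HV HV') as Q.
      rewrite Ex in Q. apply Q. intros j. apply DV.
  - lra.
Qed.

(** Packs the characteristics and [V] into one real function, to which the abstract fixed point
    applies. *)
Inductive state_index := IX (i : nat) (s t y : R) | IV (i : nat) (t y : R).

Lemma characteristic_fixed_point (d K C : R) p l :
  small_system d K C p l ->
  exists X V, admissible_X X /\ admissible_V d K V /\
    (forall i s t y, X i s t y = next_X d l X V i s t y) /\
    (forall i t y, V i t y = next_V d p X V i t y).
Proof.
  intros H. pose proof H as (Hd & HK & HC & Hs & Hp & Hl).
  assert (Hd0 : 0 < d) by lra. assert (Hd1 : 0 <= d) by lra.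
  set (Xof := fun (z : state_index -> R) i s t y => z (IX i s t y)).
  set (Vof := fun (z : state_index -> R) i t y => z (IV i t y)).
  set (F := fun z a => match a with
    | IX i s t y => next_X d l (Xof z) (Vof z) i s t y
    | IV i t y => next_V d p (Xof z) (Vof z) i t y end).
  set (P := fun z => admissible_X (Xof z) /\ admissible_V d K (Vof z)).
  set (om := fun a => match a with IX _ _ _ _ => 1 | IV _ _ _ => 8 * K end).
  (* Start: constant characteristics and U = 0. One iteration moves this by at most [om], hence the
     value 1 for the initial distance. *)
  set (z0 := fun a => match a with IX _ _ _ y => y | IV _ _ _ => 0 end).
  assert (P0 : P z0).
  { split; unfold admissible_X, admissible_V, Xof, Vof, z0; [repeat split | split].
    - intros. rewrite Rminus_diag, Rabs_R0. apply Rabs_pos.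
    - intros. rewrite Rminus_diag, Rabs_R0. apply Rabs_pos.
    - intros _ _ _ y h. replace (y + h - y) with h by ring. pose proof (Rabs_pos h). lra.
    - intros _ _ _ y h. replace (y + h - 2 * y + (y - h)) with 0 by ring.
      rewrite Rabs_R0. pose proof (pow2_ge_0 h). lra.
    - intros _ _. apply (C11_const K 0). rewrite Rabs_R0. lra.
    - intros _ t t' _. rewrite !Rmult_0_r, Rminus_diag, Rabs_R0.
      pose proof (Rabs_pos (t - t')). nra. }
  destruct (weighted_contraction_fixed_point state_index om P F (3 / 4) 1 z0)
    as (z & (PX & PV) & Hz); try lra; try assumption.
  - intros [|]; simpl; lra.
  - intros z (PX & PV). split.
    + apply (next_X_admissible d K C p l (Xof z) (Vof z)); assumption.
    + apply (next_V_admissible d K C p l (Xof z) (Vof z)); assumption.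
  - intros z w e (PX & PV) (PX' & PV') He D.
    assert (DX : forall i s t y, Rabs (Xof z i s t y - Xof w i s t y) <= e).
    { intros i s t y. rewrite <- (Rmult_1_r e). apply (D (IX i s t y)). }
    assert (DV : forall i t y, Rabs (Vof z i t y - Vof w i t y) <= 8 * K * e).
    { intros i t y. rewrite (Rmult_comm (8 * K)). apply (D (IV i t y)). }
    intros [i s t y | i t y]; simpl.
    + rewrite Rmult_1_r.
      apply (next_X_contracts d K C e p l (Xof z) (Vof z) (Xof w) (Vof w)); assumption.
    + rewrite Rmult_assoc, (Rmult_comm e).
      apply (next_V_contracts d K C e p l (Xof z) (Vof z) (Xof w) (Vof w)); assumption.
  - destruct P0 as (PX & PV). intros [i s t y | i t y]; simpl.
    + unfold next_X.
      match goal with |- Rabs (y - ?u - y) <= _ =>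
        replace (y - u - y) with (- u) by ring end.
      rewrite Rabs_Ropp.
      destruct (clamp_RInt_bound d (d * C) s t
        (fun r => fld d (l i) (Vof z0) r (Xof z0 i r t y)) Hd1) as (_ & Q).
      * nra.
      * intros x. apply (fld_along_continuous d K C C); auto.
      * intros x. apply (fld_bound d K C C); auto.
      * assert (d * C <= / 64) by nra. assert (0 <= d * C) by nra. nra.
    + rewrite Rminus_0_r.
      destruct (next_V_admissible d K C p l (Xof z0) (Vof z0) H PX PV) as (Q & _).
      eapply Rle_trans; [apply (C11_bound K _ y (Q i t)) | lra].
  - intros zn z Hn Hlim. unfold P, admissible_X, admissible_V.
    split; [repeat split | split].
    + intros i s s' t y. apply (is_lim_seq_Rabs_le (fun n => zn n (IX i s t y) - zn n (IX i s' t y))).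
      * apply is_lim_seq_minus'; apply Hlim.
      * intros n. apply (proj1 (Hn n)).
    + intros i s t t' y. apply (is_lim_seq_Rabs_le (fun n => zn n (IX i s t y) - zn n (IX i s t' y))).
      * apply is_lim_seq_minus'; apply Hlim.
      * intros n. apply (proj1 (Hn n)).
    + intros i s t y h.
      apply (is_lim_seq_Rabs_le (fun n => zn n (IX i s t (y + h)) - zn n (IX i s t y))).
      * apply is_lim_seq_minus'; apply Hlim.
      * intros n. apply (proj1 (Hn n)).
    + intros i s t y h.
      apply (is_lim_seq_Rabs_le (fun n => zn n (IX i s t (y + h)) - 2 * zn n (IX i s t y)
                                          + zn n (IX i s t (y - h)))).
      * apply is_lim_seq_plus'; [apply is_lim_seq_minus' |]; try apply Hlim.
        apply (is_lim_seq_scal_l _ 2 (z (IX i s t y))), Hlim.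
      * intros n. apply (proj1 (Hn n)).
    + intros i t y h.
      apply (tri_lim _ _ _ (fun n => zn n (IV i t (y + h))) (fun n => zn n (IV i t y))
               (fun n => zn n (IV i t (y - h)))); try apply Hlim.
      intros n. apply (proj1 (proj2 (Hn n))).
    + intros i t t' y.
      apply (is_lim_seq_Rabs_le (fun n => clamp d t ^ 2 * zn n (IV i t y)
                                          - clamp d t' ^ 2 * zn n (IV i t' y))).
      * apply is_lim_seq_minus';
          [apply (is_lim_seq_scal_l _ _ (z (IV i t y)))
          | apply (is_lim_seq_scal_l _ _ (z (IV i t' y)))]; apply Hlim.
      * intros n. apply (proj2 (proj2 (Hn n))).
  - exists (Xof z), (Vof z). split; [exact PX | split; [exact PV | split]].
    + intros i s t y. symmetry. apply (Hz (IX i s t y)).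
    + intros i t y. symmetry. apply (Hz (IV i t y)).
Qed.

(** * From the fixed point to a classical solution *)

(** Takes the place of Gronwall's lemma: iterating from [B] gives the bounds B / 2^n. *)
Lemma halving_eq_zero (A : Type) (D : A -> R) (B : R) :
  (forall a, Rabs (D a) <= B) ->
  (forall e, (forall a, Rabs (D a) <= e) -> forall a, Rabs (D a) <= e / 2) ->
  forall a, D a = 0.
Proof.
  intros HB Hh a.
  assert (Hn : forall n a, Rabs (D a) <= B * (/ 2) ^ n).
  { induction n as [|n IH]; intros b; simpl.
    - rewrite Rmult_1_r. apply HB.
    - replace (B * (/ 2 * (/ 2) ^ n)) with (B * (/ 2) ^ n / 2) by field. apply Hh, IH. }
  assert (L : is_lim_seq (fun n => B * (/ 2) ^ n) 0).
  { replace (Finite 0) with (Finite (B * 0)) by (f_equal; ring).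
    apply (is_lim_seq_scal_l (fun n => (/ 2) ^ n) _ 0), is_lim_seq_geom.
    rewrite Rabs_right; lra. }
  pose proof (is_lim_seq_le (fun _ => Rabs (D a)) _ _ _ (fun n => Hn n a)
                (is_lim_seq_const _) L) as Q.
  simpl in Q. destruct (Req_dec (D a) 0) as [E | E]; [exact E |].
  pose proof (Rabs_pos_lt _ E). lra.
Qed.

(** The characteristic through (t', y) and the one restarted from its own position at time t satisfy
    the same integral equation with the same value at t. Their difference is bounded by d (d C) <=
    1/2 times any bound of itself, so it vanishes. *)
Lemma characteristics_semigroup (d K C : R) p l X V :
  small_system d K C p l -> admissible_X X -> admissible_V d K V ->
  (forall i s t y, X i s t y = next_X d l X V i s t y) ->
  forall i s t t' y, X i s t' y = X i s t (X i t t' y).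
Proof.
  intros (Hd & HK & HC & Hs & _ & Hl) HX HV EX i s t t' y.
  assert (Hd0 : 0 < d) by lra. assert (Hd1 : 0 <= d) by lra.
  assert (HdC : d * C <= / 64) by nra. assert (HdC0 : 0 <= d * C) by nra.
  assert (Cont : forall t y x, continuous (fun r : R => fld d (l i) V r (X i r t y)) x).
  { intros t0 y0 x. apply (fld_along_continuous d K C C); auto. }
  set (z := X i t t' y).
  assert (E : forall s, X i s t' y - X i s t z =
     RInt (fun r : R => fld d (l i) V r (X i r t z) - fld d (l i) V r (X i r t' y))
       (clamp d s) (clamp d t)).
  { intros r. rewrite (EX i r t' y), (EX i r t z).
    assert (Ez : z = next_X d l X V i t t' y) by apply EX.
    unfold next_X in *.
    rewrite (RInt_chain (fun r0 : R => fld d (l i) V r0 (X i r0 t' y)) (clamp d r) (clamp d t))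
      by apply Cont.
    rewrite <- RInt_sub by apply Cont. lra. }
  apply Rminus_diag_uniq.
  apply (halving_eq_zero R (fun s => X i s t' y - X i s t z) (d * (2 * (d * C)))).
  - intros r. rewrite E. apply clamp_RInt_bound; auto.
    + lra.
    + intros x. apply continuous_sub; apply Cont.
    + intros x. replace (2 * (d * C)) with (d * C + d * C) by ring.
      apply Rabs_minus_le; apply (fld_bound d K C C); auto.
  - intros e He r. rewrite E.
    assert (He0 : 0 <= e) by (pose proof (He 0); pose proof (Rabs_pos (X i 0 t' y - X i 0 t z)); lra).
    assert (d * C * e <= e / 2) by nra. assert (0 <= d * C * e) by nra.
    apply Rle_trans with (d * (d * C * e)); [| nra].
    apply clamp_RInt_bound; auto.
    + intros x. apply continuous_sub; apply Cont.
    + intros x. eapply Rle_trans; [apply (fld_lip d K C C); auto |].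
      apply Rmult_le_compat_l; [lra |]. rewrite Rabs_minus_sym. apply He.
Qed.

Lemma RInt_close (f : R -> R) (a b v eps : R) :
  (forall x, continuous f x) -> (forall x, Rmin a b <= x <= Rmax a b -> Rabs (f x - v) <= eps) ->
  Rabs (RInt f a b - (b - a) * v) <= Rabs (b - a) * eps.
Proof.
  intros Hc H.
  assert (E : RInt (fun _ : R => v) a b = (b - a) * v).
  { rewrite RInt_const. reflexivity. }
  rewrite <- E, RInt_sub; [| exact Hc | intros x; apply continuous_const].
  apply RInt_abs_le_const; [| exact H].
  intros x. apply continuous_sub; [apply Hc | apply continuous_const].
Qed.

(** The constant 16K is 4K for each of four components, where 4K comes from the Lipschitz bound on
    [Derive] and dominates the bounds of U and of its first derivative. *)
Lemma fuchsian_system_solvable (d K C : R) p l :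
  small_system d K C p l ->
  exists U Ut Uy : nat -> R -> R -> R,
    class_F (16 * K) d U Ut Uy /\
    (forall i t y, 0 < t <= d -> Rabs (U i t y / t ^ 2) <= K) /\
    forall i t y, 0 < t <= d ->
      Ut i t y + t * l i t y (fun j => U j t y / t ^ 2) * Uy i t y
      = t * p i t y (fun j => U j t y / t ^ 2).
Proof.
  intros H. pose proof H as (Hd & HK & HC & Hs & Hp & Hl).
  assert (Hd0 : 0 < d) by lra. assert (Hd1 : 0 <= d) by lra.
  destruct (characteristic_fixed_point d K C p l H) as (X & V & HX & HV & EX & EV).
  pose proof (characteristics_semigroup d K C p l X V H HX HV EX) as SG.
  pose proof HX as (X1 & X2 & _). pose proof HV as (V1 & V2).
  assert (HdC : d * C <= / 64) by nra. assert (HdC0 : 0 <= d * C) by nra.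
  assert (Contl : forall i t y x, continuous (fun r : R => fld d (l i) V r (X i r t y)) x).
  { intros i t0 y0 x. apply (fld_along_continuous d K C C); auto. }
  assert (Contp : forall i t y x, continuous (fun r : R => fld d (p i) V r (X i r t y)) x).
  { intros i t0 y0 x. apply (fld_along_continuous d K (5 / 4 * K) (5 / 4)); auto; lra. }
  set (U := fun i t y => clamp d t ^ 2 * V i t y).
  set (Uy := fun i t y => Derive (U i t) y).
  (* The time derivative is defined by the equation; what remains is to prove that it is the
     derivative of U. *)
  set (Ut := fun i t y => fld d (p i) V t y - fld d (l i) V t y * Uy i t y).
  assert (UC : forall i t, C11 (clamp d t ^ 2 * K) (U i t)).
  { intros i t. apply (C11_scal K (clamp d t ^ 2)); [apply pow2_ge_0 | apply V1]. }
  assert (UK : forall i t, C11 K (U i t)).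
  { intros i t y h. apply tri_weaken with (clamp d t ^ 2 * K).
    - apply Rabs_pos. - apply pow2_ge_0.
    - pose proof (clamp_bounds d t Hd1). assert (clamp d t ^ 2 <= 1) by nra. nra.
    - apply UC. }
  assert (EU : forall i t y, U i t y = RInt (fun r : R => fld d (p i) V r (X i r t y)) 0 (clamp d t)).
  { intros i t y. unfold U. rewrite EV. apply next_V_clamp. }
  assert (EU2 : forall i t t' y, U i t' y = U i t (X i t t' y)
            + RInt (fun r : R => fld d (p i) V r (X i r t' y)) (clamp d t) (clamp d t')).
  { intros i t t' y. rewrite !EU, (RInt_chain _ 0 (clamp d t)) by apply Contp.
    f_equal. apply RInt_ext. intros r _. rewrite <- SG. reflexivity. }
  assert (X0 : forall i t y, X i t t y = y).
  { intros i t y. rewrite EX. unfold next_X. rewrite RInt_point. unfold zero; simpl. ring. }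
  assert (UyC : forall i, cont_on d (Uy i)).
  { intros i t y Ht eps Heps.
    (* Interpolation step: k is fixed first so that the curvature term is eps/4; then |t' - t| is
       taken small enough for the term divided by k. *)
    set (k := eps / (16 * K)). assert (Hk : 0 < k) by (apply Rdiv_lt_0_compat; lra).
    assert (Ek : 4 * K * k = eps / 4) by (unfold k; field; lra).
    set (del := Rmin (eps / (16 * K)) (eps * k / (24 * K))).
    assert (Hdel : 0 < del).
    { apply Rmin_glb_lt; [exact Hk |]. apply Rdiv_lt_0_compat; [nra | lra]. }
    exists del. split; [exact Hdel |]. intros t' y' Ht' Dt Dy.
    assert (L1 : del <= eps / (16 * K)) by apply Rmin_l.
    assert (L2 : del <= eps * k / (24 * K)) by apply Rmin_r.
    assert (Q1 : Rabs (Uy i t' y' - Uy i t' y) <= 4 * K * Rabs (y' - y))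
      by (apply (C11_Derive_lip K (U i t')), UK).
    assert (Q2 : Rabs (Uy i t' y - Uy i t y) <= 2 * (3 * K * Rabs (t' - t)) / k + 4 * K * k).
    { apply (C11_Derive_diff K _ k (U i t') (U i t));
        [apply UK | apply UK | intros z; apply V2 | exact Hk]. }
    assert (B1 : 4 * K * Rabs (y' - y) < eps / 4).
    { replace (eps / 4) with (4 * K * (eps / (16 * K))) by (field; lra).
      apply Rmult_lt_compat_l; lra. }
    assert (B2 : 2 * (3 * K * Rabs (t' - t)) / k <= eps / 4).
    { apply Rmult_le_reg_r with k; [exact Hk |].
      replace (2 * (3 * K * Rabs (t' - t)) / k * k) with (6 * K * Rabs (t' - t)) by (field; lra).
      replace (eps / 4 * k) with (6 * K * (eps * k / (24 * K))) by (field; lra).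
      apply Rmult_le_compat_l; lra. }
    pose proof (Rabs_plus_le _ _ _ _ Q1 Q2) as Q.
    replace (Uy i t' y' - Uy i t' y + (Uy i t' y - Uy i t y))
      with (Uy i t' y' - Uy i t y) in Q by ring. lra. }
  assert (UyB : forall i t y, Rabs (Uy i t y) <= K)
    by (intros i t y; apply (C11_Derive_bound K (U i t)), UK).
  assert (D1 : forall i, C1_on d (U i) (Ut i) (Uy i)).
  { intros i. repeat split.
    - intros t y Ht eps Heps. exists (eps / (4 * K)).
      split; [apply Rdiv_lt_0_compat; lra |]. intros t' y' Ht' Dt Dy.
      pose proof (Rabs_plus_le _ _ _ _ (C11_lip K (U i t') y' y (UK i t')) (V2 i t' t y)) as Q.
      fold (U i t' y) (U i t y) in Q.
      replace (U i t' y' - U i t' y + (U i t' y - U i t y))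
        with (U i t' y' - U i t y) in Q by ring.
      assert (eps / (4 * K) * (4 * K) = eps) by (field; lra). nra.
    - intros t y Ht eps Heps.
      destruct (C11_taylor K (U i t) y (UK i t)) as (_ & T).
      fold (Uy i t y) in T.
      set (e1 := eps / (4 * (1 + K))).
      assert (He1 : 0 < e1) by (apply Rdiv_lt_0_compat; lra).
      destruct (fld_cont d K (5 / 4 * K) (5 / 4) (p i) V t y e1 Hd0 ltac:(lra) (Hp i) HV He1)
        as (dp & Hdp & Fp).
      destruct (fld_cont d K C C (l i) V t y e1 Hd0 HC (Hl i) HV He1) as (dl & Hdl & Fl).
      set (del := Rmin (Rmin dp dl) e1).
      exists del. split; [repeat apply Rmin_glb_lt; assumption |].
      intros h Hh Hlt Hth.
      assert (L1 : del <= Rmin dp dl) by apply Rmin_l. assert (L2 : del <= e1) by apply Rmin_r.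
      assert (L3 : Rmin dp dl <= dp) by apply Rmin_l. assert (L4 : Rmin dp dl <= dl) by apply Rmin_r.
      assert (Near : forall r, Rmin t (t + h) <= r <= Rmax t (t + h) ->
                Rabs (r - t) <= Rabs h /\ Rabs (X i r (t + h) y - y) <= Rabs h).
      { intros r Hr. split.
        - unfold Rmin, Rmax in Hr. destruct (Rle_dec t (t + h));
          unfold Rabs; repeat destruct Rcase_abs; lra.
        - pose proof (X1 i r (t + h) (t + h) y) as Q. rewrite X0 in Q.
          eapply Rle_trans; [exact Q |].
          unfold Rmin, Rmax in Hr. destruct (Rle_dec t (t + h));
          unfold Rabs; repeat destruct Rcase_abs; lra. }
      pose proof (EU2 i t (t + h) y) as E. rewrite !clamp_id in E by lra.
      set (x := X i t (t + h) y) in *.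
      assert (Ex : x - y = - RInt (fun r : R => fld d (l i) V r (X i r (t + h) y)) t (t + h)).
      { unfold x. rewrite EX. unfold next_X. rewrite !clamp_id by lra. ring. }
      assert (Ix := RInt_close (fun r : R => fld d (l i) V r (X i r (t + h) y)) t (t + h)
                      (fld d (l i) V t y) e1 (Contl i (t + h) y)).
      assert (Ip := RInt_close (fun r : R => fld d (p i) V r (X i r (t + h) y)) t (t + h)
                      (fld d (p i) V t y) e1 (Contp i (t + h) y)).
      replace (t + h - t) with h in Ix, Ip by ring.
      assert (Ix' : Rabs (x - y + h * fld d (l i) V t y) <= Rabs h * e1).
      { rewrite Ex. rewrite <- Rabs_Ropp.
        match goal with |- Rabs ?u <= _ => match type of Ix with _ -> Rabs ?w <= _ =>
          replace u with w by ring end end.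
        apply Ix. intros r Hr. destruct (Near r Hr). apply Rlt_le, Fl; lra. }
      assert (Ip' := Ip ltac:(intros r Hr; destruct (Near r Hr); apply Rlt_le, Fp; lra)).
      assert (Dx : Rabs (x - y) <= Rabs h).
      { apply (Near t). unfold Rmin, Rmax. destruct (Rle_dec t (t + h)); lra. }
      specialize (T (x - y)). replace (y + (x - y)) with x in T by ring.
      (* Characteristics have slope at most 1, so |x - y| <= |h| < e1 and the quadratic Taylor
         remainder is o(h). *)
      assert (Dx2 : (x - y) ^ 2 <= Rabs h * e1).
      { rewrite <- (pow2_abs (x - y)). pose proof (Rabs_pos (x - y)). nra. }
      pose proof (Rabs_plus_le _ _ _ _ (Rabs_plus_le _ _ _ _ T Ip')
                    (Rabs_mult_le _ _ _ _ (UyB i t y) Ix')) as Q.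
      assert (Hh0 : 0 < Rabs h) by (apply Rabs_pos_lt; exact Hh).
      (* Three errors: Taylor expansion of U at the fixed time t, the source integral against its
         value at (t, y), and the displacement x - y against -h times the speed. Together they are
         at most (3K + 1) e1 |h|, below 4 (1 + K) e1 |h| = eps |h|. *)
      assert (EQ : U i (t + h) y - U i t y - h * Ut i t y =
        U i t x - U i t y - Uy i t y * (x - y)
        + (RInt (fun r : R => fld d (p i) V r (X i r (t + h) y)) t (t + h)
           - h * fld d (p i) V t y)
        + Uy i t y * (x - y + h * fld d (l i) V t y)).
      { rewrite E. unfold Ut. ring. }
      rewrite <- EQ in Q.
      replace ((U i (t + h) y - U i t y) / h - Ut i t y)
        with ((U i (t + h) y - U i t y - h * Ut i t y) / h) by (field; exact Hh).
      unfold Rdiv at 1. rewrite Rabs_mult, Rabs_inv.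
      apply Rmult_lt_reg_r with (Rabs h); [exact Hh0 |].
      rewrite Rmult_assoc, Rinv_l, Rmult_1_r by lra.
      eapply Rle_lt_trans; [exact Q |].
      assert (Ee : eps = e1 * (4 * (1 + K))) by (unfold e1; field; lra).
      rewrite Ee. assert (0 < Rabs h * e1) by nra.
      assert (2 * K * (x - y) ^ 2 <= 2 * K * (Rabs h * e1)) by (apply Rmult_le_compat_l; lra).
      nra.
    - intros t y Ht. apply (C11_taylor K (U i t) y (UK i t)).
    - intros t y Ht eps Heps.
      set (e1 := eps / (2 * (2 + K))).
      assert (He1 : 0 < e1) by (apply Rdiv_lt_0_compat; lra).
      destruct (fld_cont d K (5 / 4 * K) (5 / 4) (p i) V t y e1 Hd0 ltac:(lra) (Hp i) HV He1)
        as (dp & Hdp & Fp).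
      destruct (fld_cont d K C C (l i) V t y e1 Hd0 HC (Hl i) HV He1) as (dl & Hdl & Fl).
      destruct (UyC i t y Ht e1 He1) as (du & Hdu & Fu).
      set (del := Rmin (Rmin dp dl) du).
      exists del. split; [repeat apply Rmin_glb_lt; assumption |].
      intros t' y' Ht' Dt Dy.
      assert (L1 : del <= Rmin dp dl) by apply Rmin_l. assert (L2 : del <= du) by apply Rmin_r.
      assert (L3 : Rmin dp dl <= dp) by apply Rmin_l. assert (L4 : Rmin dp dl <= dl) by apply Rmin_r.
      specialize (Fp t' y' ltac:(lra) ltac:(lra)). specialize (Fl t' y' ltac:(lra) ltac:(lra)).
      specialize (Fu t' y' Ht' ltac:(lra) ltac:(lra)).
      assert (Bl : Rabs (fld d (l i) V t y) <= 1).
      { eapply Rle_trans; [apply (fld_bound d K C C); auto | lra]. }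
      pose proof (Rabs_minus_le _ _ _ _ (Rlt_le _ _ Fp)
        (Rabs_plus_le _ _ _ _ (Rabs_mult_le _ _ _ _ (Rlt_le _ _ Fl) (UyB i t' y'))
           (Rabs_mult_le _ _ _ _ Bl (Rlt_le _ _ Fu)))) as Q.
      match type of Q with Rabs ?w <= _ =>
        replace w with (Ut i t' y' - Ut i t y) in Q by (unfold Ut; ring) end.
      eapply Rle_lt_trans; [exact Q |].
      assert (Ee : eps = e1 * (2 * (2 + K))) by (unfold e1; field; lra).
      rewrite Ee. nra.
    - apply UyC. }
  exists U, Ut, Uy. split; [| split].
  - split; [| split; [| split; [| split]]].
    + intros i _. apply D1.
    + intros i _ y. unfold Ut, U, fld. rewrite clamp_0 by lra. split; ring.
    + exists (fun _ => 4 * K). split; [| lra]. intros i _ t y Ht.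
      pose proof (C11_bound _ _ y (UC i t)) as Q. rewrite clamp_id in Q by lra.
      pose proof (pow2_ge_0 t). nra.
    + exists (fun _ => 4 * K). split; [| lra]. intros i _ t y Ht.
      pose proof (C11_Derive_bound _ _ y (UC i t)) as Q. rewrite clamp_id in Q by lra.
      fold (Uy i t y) in Q. pose proof (pow2_ge_0 t). nra.
    + exists (fun _ => 4 * K). split; [| lra]. intros i _ t y z Ht.
      pose proof (C11_Derive_lip _ _ y z (UC i t)) as Q. rewrite clamp_id in Q by lra.
      fold (Uy i t y) (Uy i t z) in Q. eapply Rle_trans; [exact Q | right; ring].
  - intros i t y Ht. unfold U. rewrite clamp_id by lra.
    replace (t ^ 2 * V i t y / t ^ 2) with (V i t y) by (field; lra).
    apply (C11_bound K (V i t)), V1.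
  - intros i t y Ht.
    assert (EV2 : (fun j => U j t y / t ^ 2) = (fun j => V j t y)).
    { apply functional_extensionality. intros j.
      unfold U. rewrite clamp_id by lra. field. lra. }
    rewrite EV2. unfold Ut, fld. rewrite clamp_id by lra. ring.
Qed.

(** * Coefficients of Fuchsian type *)

(** One constant serves all |lam| <= 1, so K and d can be fixed before lam. The points need not be
    equally spaced and n is independent of e apart from e^2 <= n; this lets the same clause yield
    both C^{1,1} bounds in y and Lipschitz bounds in w. *)
Definition tri_bounded (d C : R) (E : R -> R -> R -> (nat -> R) -> R) : Prop :=
  forall lam t e n y1 y2 y3 w1 w2 w3,
    Rabs lam <= 1 -> 0 < t <= d -> 0 <= e -> e ^ 2 <= n ->
    Rabs (y1 - y2) <= e -> Rabs (y3 - y2) <= e -> Rabs (y1 - 2 * y2 + y3) <= n ->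
    (forall j, tri e n 1 (w1 j) (w2 j) (w3 j)) ->
    tri e n C (E lam t y1 w1) (E lam t y2 w2) (E lam t y3 w3).

(* [E lam t y w] with [w = t * v = U / t]: bounds are uniform over [|w| <= 1], hence
   independent of the size of [v = U / t ^ 2] once [t] is small. *)
Definition regular (d : R) (E : R -> R -> R -> (nat -> R) -> R) : Prop :=
  (exists C, tri_bounded d C E) /\
  forall lam t y v, Rabs lam <= 1 -> 0 < t <= d -> (forall j, Rabs (t * v j) <= 1) ->
    continuity_pt (fun s => E lam s y (fun j => s * v j)) t.

Lemma tri_bounded_weaken (d C C' : R) E :
  C <= C' -> tri_bounded d C E -> tri_bounded d C' E.
Proof.
  intros HC H lam t e n y1 y2 y3 w1 w2 w3 Hl Ht He Hn H1 H3 H2 Hw.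
  apply tri_weaken with C; [exact He | pose proof (pow2_ge_0 e); lra | exact HC |].
  apply H; assumption.
Qed.

Lemma tri_bounded_value (d C : R) E lam t y w :
  tri_bounded d C E -> Rabs lam <= 1 -> 0 < t <= d -> (forall j, Rabs (w j) <= 1) ->
  Rabs (E lam t y w) <= C.
Proof.
  intros H Hl Ht Hw.
  apply (H lam t 0 0 y y y w w w); try assumption;
    try (match goal with |- Rabs ?x <= 0 => replace x with 0 by ring end; rewrite Rabs_R0); try lra.
  intros j. apply tri_weaken with (Rabs (w j)); [lra | lra | apply Hw |].
  apply tri_const; lra.
Qed.

Lemma regular_ext (d : R) E E' :
  (forall lam t y w, E lam t y w = E' lam t y w) -> regular d E' -> regular d E.
Proof.
  intros H ((C & HC) & Hc). split.
  - exists C. intros lam t e n y1 y2 y3 w1 w2 w3. rewrite !H. apply HC.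
  - intros lam t y v Hl Ht Hv.
    apply (continuity_pt_ext (fun s => E' lam s y (fun j => s * v j))).
    + intros s. symmetry. apply H.
    + apply Hc; assumption.
Qed.

Lemma regular_const (d k : R) : regular d (fun _ _ _ _ => k).
Proof.
  split.
  - exists (Rabs k). intros lam t e n y1 y2 y3 w1 w2 w3 _ _ He Hn _ _ _ _.
    apply tri_const; [exact He | pose proof (pow2_ge_0 e); lra].
  - intros. apply continuity_pt_const. intros ? ?. reflexivity.
Qed.

Lemma regular_lam (d : R) : regular d (fun lam _ _ _ => lam).
Proof.
  split.
  - exists 1. intros lam t e n y1 y2 y3 w1 w2 w3 Hl _ He Hn _ _ _ _.
    pose proof (pow2_ge_0 e).
    apply tri_weaken with (Rabs lam); try assumption; [lra |]. apply tri_const; lra.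
  - intros. apply continuity_pt_const. intros ? ?. reflexivity.
Qed.

Lemma regular_time (d C : R) (k : R -> R) :
  (forall t, 0 < t <= d -> Rabs (k t) <= C) ->
  (forall t, 0 < t <= d -> continuity_pt k t) -> regular d (fun _ t _ _ => k t).
Proof.
  intros HC Hk. split.
  - exists C. intros lam t e n y1 y2 y3 w1 w2 w3 _ Ht He Hn _ _ _ _.
    pose proof (pow2_ge_0 e).
    apply tri_weaken with (Rabs (k t)); [assumption | lra | apply HC, Ht |].
    apply tri_const; lra.
  - intros lam t y v _ Ht _. apply Hk, Ht.
Qed.

Lemma regular_t (d : R) : regular d (fun _ t _ _ => t).
Proof.
  apply (regular_time d d (fun t => t)).
  - intros t Ht. rewrite Rabs_right; lra.
  - intros t _. apply derivable_continuous_pt, derivable_pt_id.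
Qed.

Lemma regular_y (d : R) (f : R -> R) : (exists K, C11 K f) -> regular d (fun _ _ y _ => f y).
Proof.
  intros (K & HK). split.
  - exists (2 * K). intros lam t e n y1 y2 y3 w1 w2 w3 _ _ He Hn H1 H3 H2 _.
    apply C11_tri; assumption.
  - intros. apply continuity_pt_const. intros ? ?. reflexivity.
Qed.

Lemma regular_w (d : R) (j : nat) : regular d (fun _ _ _ w => w j).
Proof.
  split.
  - exists 1. intros lam t e n y1 y2 y3 w1 w2 w3 _ _ _ _ _ _ _ Hw. apply Hw.
  - intros lam t y v _ _ _. apply (continuity_pt_mult (fun s => s) (fun _ => v j)).
    + apply derivable_continuous_pt, derivable_pt_id.
    + apply continuity_pt_const. intros ? ?. reflexivity.
Qed.

Lemma regular_plus (d : R) E F :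
  regular d E -> regular d F -> regular d (fun lam t y w => E lam t y w + F lam t y w).
Proof.
  intros ((C & HC) & Hc) ((C' & HC') & Hc'). split.
  - exists (C + C'). intros lam t e n y1 y2 y3 w1 w2 w3. intros.
    apply tri_plus; [apply HC | apply HC']; assumption.
  - intros lam t y v Hl Ht Hv.
    apply (continuity_pt_plus (fun s => E lam s y (fun j => s * v j))
             (fun s => F lam s y (fun j => s * v j))); auto.
Qed.

Lemma regular_opp (d : R) E : regular d E -> regular d (fun lam t y w => - E lam t y w).
Proof.
  intros ((C & HC) & Hc). split.
  - exists C. intros lam t e n y1 y2 y3 w1 w2 w3. intros. apply tri_opp, HC; assumption.
  - intros lam t y v Hl Ht Hv.
    apply (continuity_pt_opp (fun s => E lam s y (fun j => s * v j))); auto.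
Qed.

Lemma regular_minus (d : R) E F :
  regular d E -> regular d F -> regular d (fun lam t y w => E lam t y w - F lam t y w).
Proof. intros HE HF. apply regular_plus; [exact HE | apply regular_opp, HF]. Qed.

Lemma regular_mult (d : R) E F :
  regular d E -> regular d F -> regular d (fun lam t y w => E lam t y w * F lam t y w).
Proof.
  intros ((C & HC) & Hc) ((C' & HC') & Hc'). split.
  - exists (4 * C * C'). intros lam t e n y1 y2 y3 w1 w2 w3. intros.
    apply tri_mult; try assumption; [apply HC | apply HC']; assumption.
  - intros lam t y v Hl Ht Hv.
    apply (continuity_pt_mult (fun s => E lam s y (fun j => s * v j))
             (fun s => F lam s y (fun j => s * v j))); auto.
Qed.

Lemma regular_inv (d m : R) E :
  0 < m ->
  (forall lam t y w, Rabs lam <= 1 -> 0 < t <= d -> (forall j, Rabs (w j) <= 1) ->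
     m <= E lam t y w) ->
  regular d E -> regular d (fun lam t y w => / E lam t y w).
Proof.
  intros Hm Hlow ((C & HC) & Hc). split.
  - exists (/ m + C / m ^ 2 + 2 * C ^ 2 / m ^ 3).
    intros lam t e n y1 y2 y3 w1 w2 w3 Hl Ht He Hn H1 H3 H2 Hw.
    apply tri_inv; try assumption; try (apply Hlow; [assumption | assumption |]; intros j; apply Hw).
    apply HC; assumption.
  - intros lam t y v Hl Ht Hv.
    apply (continuity_pt_inv (fun s => E lam s y (fun j => s * v j))); [auto |].
    pose proof (Hlow lam t y (fun j => t * v j) Hl Ht Hv). lra.
Qed.

Ltac regular_tac :=
  repeat first
    [ assumption
    | apply regular_const | apply regular_lam | apply regular_t | apply regular_w
    | apply regular_minus | apply regular_plus | apply regular_opp | apply regular_mult ].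

(** Under t K <= 1 the scaling by t turns the constant K of v into 1, so K disappears from the
    conclusion. *)
Lemma regular_tri_v (d K C : R) E lam t e n y1 y2 y3 (v1 v2 v3 : nat -> R) :
  tri_bounded d C E -> Rabs lam <= 1 -> 0 < t <= d -> t * K <= 1 -> 0 <= e -> e ^ 2 <= n ->
  Rabs (y1 - y2) <= e -> Rabs (y3 - y2) <= e -> Rabs (y1 - 2 * y2 + y3) <= n ->
  (forall j, tri e n K (v1 j) (v2 j) (v3 j)) ->
  tri e n C (E lam t y1 (fun j => t * v1 j)) (E lam t y2 (fun j => t * v2 j))
    (E lam t y3 (fun j => t * v3 j)).
Proof.
  intros H Hl Ht HK He Hn H1 H3 H2 Hv. apply H; try assumption.
  intros j. apply tri_weaken with (t * K); [assumption | pose proof (pow2_ge_0 e); lra | exact HK |].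
  rewrite <- (Rabs_right t) at 1 by lra. apply tri_scal, Hv.
Qed.

(* A pair of values is the degenerate triple [p, q, q] with [n = e + e ^ 2]. *)
Lemma regular_lip_v (d K C e : R) E lam t y (v w : nat -> R) :
  tri_bounded d C E -> Rabs lam <= 1 -> 0 < t <= d -> t * K <= 1 ->
  (forall j, Rabs (v j) <= K) -> (forall j, Rabs (w j) <= K) ->
  (forall j, Rabs (v j - w j) <= e) ->
  Rabs (E lam t y (fun j => t * v j) - E lam t y (fun j => t * w j)) <= C * (t * e).
Proof.
  intros H Hl Ht HK Hv Hw He.
  assert (He0 : 0 <= e) by (pose proof (He 0%nat); pose proof (Rabs_pos (v 0%nat - w 0%nat)); lra).
  assert (Hte : 0 <= t * e) by nra.
  apply (H lam t (t * e) (t * e + (t * e) ^ 2) y y y (fun j => t * v j) (fun j => t * w j)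
           (fun j => t * w j)); try assumption;
    try (match goal with |- Rabs ?x <= _ => replace x with 0 by ring end; rewrite Rabs_R0);
    try (pose proof (pow2_ge_0 (t * e)); lra).
  intros j. pose proof (pow2_ge_0 (t * e)).
  assert (B : forall x, Rabs x <= K -> Rabs (t * x) <= 1).
  { intros x Hx. rewrite Rabs_mult, (Rabs_right t) by lra. nra. }
  assert (D : Rabs (t * v j - t * w j) <= t * e).
  { rewrite <- Rmult_minus_distr_l, Rabs_mult, (Rabs_right t) by lra.
    apply Rmult_le_compat_l; [lra | apply He]. }
  repeat split; try (apply B; auto).
  - lra.
  - rewrite Rminus_diag, Rabs_R0. lra.
  - replace (t * v j - 2 * (t * w j) + t * w j) with (t * v j - t * w j) by ring. lra.
Qed.

Lemma C11_points (y h : R) :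
  Rabs (y + h - y) <= Rabs h /\ Rabs (y - h - y) <= Rabs h /\
  Rabs (y + h - 2 * y + (y - h)) <= h ^ 2.
Proof.
  replace (y + h - y) with h by ring. replace (y - h - y) with (- h) by ring.
  replace (y + h - 2 * y + (y - h)) with 0 by ring. rewrite Rabs_Ropp, Rabs_R0.
  pose proof (pow2_ge_0 h). lra.
Qed.

Lemma scaled_le_1 (K t x : R) : 0 < t -> t * K <= 1 -> Rabs x <= K -> Rabs (t * x) <= 1.
Proof. intros Ht HK Hx. rewrite Rabs_mult, (Rabs_right t) by lra. nra. Qed.

Lemma good_coef_of_regular (d0 d K C lam : R) E :
  regular d0 E -> tri_bounded d0 C E -> 0 < d <= d0 -> d <= 1 -> 0 <= K -> d * K <= 1 ->
  Rabs lam <= 1 -> 0 <= C ->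
  good_coef d K C C (fun t y v => E lam t y (fun j => t * v j)).
Proof.
  intros (_ & Hc) HC Hd Hd1 HK HdK Hl HC0.
  assert (HtK : forall t, 0 < t <= d -> t * K <= 1) by (intros t Ht; nra).
  repeat apply conj.
  - intros t W Ht HW y h. destruct (C11_points y h) as (P1 & P2 & P3).
    apply (regular_tri_v d0 K C E lam t (Rabs h) (h ^ 2) (y + h) y (y - h)
             (fun j => W j (y + h)) (fun j => W j y) (fun j => W j (y - h))); auto; try lra.
    + apply Rabs_pos.
    + rewrite pow2_abs. lra.
    + intros j. apply HW.
  - intros t y v w e Ht Hv Hw He.
    assert (0 <= e) by (pose proof (He 0%nat); pose proof (Rabs_pos (v 0%nat - w 0%nat)); lra).
    eapply Rle_trans; [apply (regular_lip_v d0 K C e E lam t y v w); auto; lra |].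
    apply Rmult_le_compat_l; [lra | nra].
  - intros t y v Ht Hv. apply Hc; [assumption | lra |].
    intros j. apply (scaled_le_1 K); auto; lra.
Qed.

(* The singular part [(v a - v b) / 2] has constant exactly [K] and Lipschitz constant 1;
   the factor 5/4 stays below the 2 allowed by [int_0^t s ds = t^2 / 2]. *)
Lemma good_coef_fuchsian (d0 d K CA CE lam : R) A E (i1 i2 i3 i4 : nat) :
  regular d0 A -> tri_bounded d0 CA A -> regular d0 E -> tri_bounded d0 CE E ->
  0 < d <= d0 -> d <= 1 -> 0 < K -> d * K <= 1 -> Rabs lam <= 1 ->
  0 <= CA -> 0 <= CE -> Rabs lam * CA <= / 64 -> 8 * CE <= K -> 8 * (d * CE) <= 1 ->
  good_coef d K (5 / 4 * K) (5 / 4)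
    (fun t y v => / 2 * (v i1 - v i2)
       + lam * (A lam t y (fun j => t * v j) * (v i3 - v i4))
       + E lam t y (fun j => t * v j)).
Proof.
  intros (_ & HcA) HA (_ & HcE) HE Hd Hd1 HK HdK Hl HA0 HE0 HlA HKE HdE.
  assert (HtK : forall t, 0 < t <= d -> t * K <= 1) by (intros t Ht; nra).
  pose proof (Rabs_pos lam) as Hl0.
  repeat apply conj.
  - intros t W Ht HW y h. destruct (C11_points y h) as (P1 & P2 & P3).
    pose proof (Rabs_pos h) as Hh. pose proof (pow2_ge_0 h) as Hh2.
    assert (Hhh : Rabs h ^ 2 <= h ^ 2) by (rewrite pow2_abs; lra).
    assert (HW' : forall j, tri (Rabs h) (h ^ 2) K (W j (y + h)) (W j y) (W j (y - h)))
      by (intros j; apply HW).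
    (* Budget: the singular part gives K, the lam-term 8 |lam| CA K <= K/8, and E gives CE <= K/8,
       in total 5/4 K. *)
    apply tri_weaken with
      (Rabs (/ 2) * (K + K) + Rabs lam * (4 * CA * (K + K)) + CE); try assumption.
    + rewrite Rabs_right by lra. nra.
    + apply tri_plus; [apply tri_plus |].
      * apply tri_scal, tri_minus; apply HW'.
      * apply tri_scal, tri_mult; try assumption; [| apply tri_minus; apply HW'].
        apply (regular_tri_v d0 K CA A lam t (Rabs h) (h ^ 2) (y + h) y (y - h)
             (fun j => W j (y + h)) (fun j => W j y) (fun j => W j (y - h))); auto; lra.
      * apply (regular_tri_v d0 K CE E lam t (Rabs h) (h ^ 2) (y + h) y (y - h)
             (fun j => W j (y + h)) (fun j => W j y) (fun j => W j (y - h))); auto; lra.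
  - intros t y v w e Ht Hv Hw He.
    assert (He0 : 0 <= e) by (pose proof (He 0%nat); pose proof (Rabs_pos (v 0%nat - w 0%nat)); lra).
    set (Av := A lam t y (fun j => t * v j)). set (Aw := A lam t y (fun j => t * w j)).
    set (Ev := E lam t y (fun j => t * v j)). set (Ew := E lam t y (fun j => t * w j)).
    assert (DA : Rabs (Av - Aw) <= CA * (t * e)) by (apply (regular_lip_v d0 K); auto; lra).
    assert (DE : Rabs (Ev - Ew) <= CE * (t * e)) by (apply (regular_lip_v d0 K); auto; lra).
    assert (BA : Rabs Av <= CA).
    { apply (tri_bounded_value d0); auto; [lra |].
      intros j. apply (scaled_le_1 K); auto; lra. }
    assert (D2 : forall a b, Rabs ((v a - v b) - (w a - w b)) <= e + e).
    { intros a b. replace (v a - v b - (w a - w b)) with ((v a - w a) - (v b - w b)) by ring.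
      apply Rabs_minus_le; apply He. }
    assert (B2 : forall a b, Rabs (w a - w b) <= K + K)
      by (intros a b; apply Rabs_minus_le; apply Hw).
    replace (/ 2 * (v i1 - v i2) + lam * (Av * (v i3 - v i4)) + Ev
             - (/ 2 * (w i1 - w i2) + lam * (Aw * (w i3 - w i4)) + Ew))
      with (/ 2 * ((v i1 - v i2) - (w i1 - w i2))
            + lam * (Av * ((v i3 - v i4) - (w i3 - w i4)) + (Av - Aw) * (w i3 - w i4))
            + (Ev - Ew)) by ring.
    assert (Hhalf : Rabs (/ 2) <= / 2) by (rewrite Rabs_right; lra).
    eapply Rle_trans.
    { apply Rabs_plus_le; [apply Rabs_plus_le |].
      - apply Rabs_mult_le; [exact Hhalf | apply D2].
      - apply Rabs_mult_le; [apply Rle_refl |].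
        apply Rabs_plus_le; apply Rabs_mult_le; [exact BA | apply D2 | exact DA | apply B2].
      - exact DE. }
    pose proof (HtK t Ht) as HtK'.
    (* Lipschitz budget: e from the singular part, e/16 from the lam-term and e/8 from E, below 5/4
       e. *)
    assert (X1 : Rabs lam * (CA * (e + e) + CA * (t * e) * (K + K)) <= / 64 * (4 * e)).
    { replace (Rabs lam * (CA * (e + e) + CA * (t * e) * (K + K)))
        with (Rabs lam * CA * ((2 + 2 * (t * K)) * e)) by ring.
      assert (0 <= t * K) by nra.
      apply Rmult_le_compat; nra. }
    assert (X2 : 8 * (CE * (t * e)) <= e).
    { replace (8 * (CE * (t * e))) with (8 * (t * CE) * e) by ring.
      assert (t * CE <= d * CE) by nra. nra. }
    lra.
  - intros t y v Ht Hv.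
    assert (Hv' : forall j, Rabs (t * v j) <= 1) by (intros j; apply (scaled_le_1 K); auto; lra).
    apply (continuity_pt_plus
      (fun s => / 2 * (v i1 - v i2) + lam * (A lam s y (fun j => s * v j) * (v i3 - v i4)))
      (fun s => E lam s y (fun j => s * v j))); [| apply HcE; auto; lra].
    apply (continuity_pt_plus (fun s => / 2 * (v i1 - v i2))
      (fun s => lam * (A lam s y (fun j => s * v j) * (v i3 - v i4)))).
    + apply continuity_pt_const. intros ? ?. reflexivity.
    + apply (continuity_pt_scal (fun s => A lam s y (fun j => s * v j) * (v i3 - v i4))).
      apply (continuity_pt_mult (fun s => A lam s y (fun j => s * v j))
               (fun s => v i3 - v i4)); [apply HcA; auto; lra |].
      apply continuity_pt_const. intros ? ?. reflexivity.
Qed.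

(** * Expansion of the right-hand sides *)

(** The term E for the first two equations. Here k0 is the value of a a'/c' at t = 0 and kap its
    difference quotient, iS the inverse of the denominator S_1 or R_1, wS the component of w in that
    denominator, and sg the sign of the last term of G_1 or G_2. In [rest34] below, kap refers to
    a'/(a c'). *)
Definition rest12 (lam sg icp aa k0 kap t iS P2 dphi g dg dpsi g21 g22 w1 w2 w3 w4 wS : R) : R :=
  / 4 * ((w1 - w2) * (w1 - w2)) * iS
  + iS * (- (2 * lam * kap * dphi)
          - kap * ((P2 + t * (w3 + g21)) * (P2 + t * (w4 + g22)))
          - k0 * ((w3 + g21) * (P2 + t * (w4 + g22)) + P2 * (w4 + g22))
          - g * (wS + g)
          - / 4 * (aa * aa) * ((w3 - w4 - 2 * dphi) * (w3 - w4 - 2 * dphi))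
          + sg * ((dpsi + dg * t) * icp)).

Definition rest34 (sg icp k kap t iS P2 Q2 dphi dg dpsi g21 g22 w1 w2 w3 w4 : R) : R :=
  / 2 * ((w1 - w2) * (w3 - w4 - 2 * dphi)) * iS
  + 2 * P2 * kap
  + k * (g21 + g22 + w3 + w4)
  + sg * (k * (w1 - w2) * Q2 * iS)
  + sg * ((dpsi + dg * t) * icp * iS).

(** The last hypothesis is the definition of g_11, that is g psi_1 = - k0 (P2^2 + 2 lam dphi), with
    psi_1 eliminated by S = psi_1 + g t + t^2 v2. It makes the terms of order zero cancel. *)
Lemma G1_expand (lam cp aa da t P2 dphi g g21 g22 dg dpsi k0 v1 v2 v3 v4 S : R) :
  t <> 0 -> cp <> 0 -> S <> 0 -> g21 = g22 - 2 * dphi ->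
  t * (g * (t * v2 + g)) = g * S + k0 * (P2 * P2 + 2 * lam * dphi) ->
  G1 lam cp aa da t (S + t * (t * v1 - t * v2)) S
     (P2 + t * (t * v3 + g21)) (P2 + t * (t * v4 + g22)) g dg dpsi
  = t * (/ 2 * (v1 - v2) + lam * (aa * da * / cp * / S * (v3 - v4))
         + rest12 lam 1 (/ cp) aa k0 ((aa * da * / cp - k0) / t) t (/ S) P2 dphi g dg dpsi
             g21 g22 (t * v1) (t * v2) (t * v3) (t * v4) (t * v2)).
Proof.
  intros Ht Hc HS -> Hg. unfold G1, rest12.
  replace (g * (t * v2 + g)) with ((g * S + k0 * (P2 * P2 + 2 * lam * dphi)) / t)
    by (rewrite <- Hg; field; exact Ht).
  field. repeat split; assumption.
Qed.

Lemma G2_expand (lam cp aa da t P2 dphi g g21 g22 dg dpsi k0 v1 v2 v3 v4 S : R) :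
  t <> 0 -> cp <> 0 -> S <> 0 -> g21 = g22 - 2 * dphi ->
  t * (g * (t * v1 + g)) = g * S + k0 * (P2 * P2 + 2 * lam * dphi) ->
  G2 lam cp aa da t S (S + t * (t * v2 - t * v1))
     (P2 + t * (t * v3 + g21)) (P2 + t * (t * v4 + g22)) g dg dpsi
  = t * (/ 2 * (v2 - v1) + lam * (aa * da * / cp * / S * (v3 - v4))
         + rest12 lam (-1) (/ cp) aa k0 ((aa * da * / cp - k0) / t) t (/ S) P2 dphi g dg dpsi
             g21 g22 (t * v1) (t * v2) (t * v3) (t * v4) (t * v1)).
Proof.
  intros Ht Hc HS -> Hg. unfold G2, rest12.
  replace (g * (t * v1 + g)) with ((g * S + k0 * (P2 * P2 + 2 * lam * dphi)) / t)
    by (rewrite <- Hg; field; exact Ht).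
  field. repeat split; assumption.
Qed.

(** Here the cancellation is explicit: at order zero (R_2 - S_2)/(2t) contributes - dphi and the
    a'/(a c') term contributes 2 k0 P2, whose sum is g21. *)
Lemma G3_expand (lam cp aa da t P2 dphi g21 g22 dg dpsi k0 v1 v2 v3 v4 S : R) :
  t <> 0 -> cp <> 0 -> S <> 0 -> aa <> 0 ->
  g21 = 2 * k0 * P2 - dphi -> g22 = 2 * k0 * P2 + dphi ->
  G3 lam cp aa da t (S + t * (t * v1 - t * v2)) S
     (P2 + t * (t * v3 + g21)) (P2 + t * (t * v4 + g22)) g21 dg dpsi
  = t * (/ 2 * (v3 - v4) + lam * (- (da * / aa * / cp * / S) * (v1 - v2))
         + rest34 1 (/ cp) (da * / aa * / cp) ((da * / aa * / cp - k0) / t) t (/ S) P2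
             (P2 + t * (t * v4 + g22)) dphi dg dpsi
             g21 g22 (t * v1) (t * v2) (t * v3) (t * v4)).
Proof.
  intros Ht Hc HS Ha -> ->. unfold G3, rest34. field. repeat split; assumption.
Qed.

Lemma G4_expand (lam cp aa da t P2 dphi g21 g22 dg dpsi k0 v1 v2 v3 v4 S : R) :
  t <> 0 -> cp <> 0 -> S <> 0 -> aa <> 0 ->
  g21 = 2 * k0 * P2 - dphi -> g22 = 2 * k0 * P2 + dphi ->
  G4 lam cp aa da t S (S + t * (t * v2 - t * v1))
     (P2 + t * (t * v3 + g21)) (P2 + t * (t * v4 + g22)) g22 dg dpsi
  = t * (/ 2 * (v4 - v3) + lam * (- (da * / aa * / cp * / S) * (v1 - v2))
         + rest34 (-1) (/ cp) (da * / aa * / cp) ((da * / aa * / cp - k0) / t) t (/ S) P2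
             (P2 + t * (t * v3 + g21)) dphi dg dpsi
             g21 g22 (t * v1) (t * v2) (t * v3) (t * v4)).
Proof.
  intros Ht Hc HS Ha -> ->. unfold G4, rest34. field. repeat split; assumption.
Qed.

(** * Coefficients depending on time through [u_*] *)

Definition lip_at_0 (f : R -> R) : Prop :=
  (exists C, forall t, 0 <= t <= 1 -> Rabs (f t) <= C /\ Rabs (f t - f 0) <= C * t) /\
  forall t, continuity_pt f t.

Lemma lip_at_0_mult (f g : R -> R) :
  lip_at_0 f -> lip_at_0 g -> lip_at_0 (fun t => f t * g t).
Proof.
  intros ((C & HC) & Hf) ((C' & HC') & Hg). split.
  - exists (2 * C * C'). intros t Ht.
    destruct (HC t Ht) as (B & D). destruct (HC' t Ht) as (B' & D').
    destruct (HC 0 ltac:(lra)) as (B0 & _).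
    pose proof (Rabs_mult_le _ _ _ _ B B') as Q.
    pose proof (Rabs_plus_le _ _ _ _ (Rabs_mult_le _ _ _ _ D B') (Rabs_mult_le _ _ _ _ B0 D')) as Q'.
    replace ((f t - f 0) * g t + f 0 * (g t - g 0)) with (f t * g t - f 0 * g 0) in Q' by ring.
    pose proof (Rabs_pos (f t * g t)). lra.
  - intros t. apply (continuity_pt_mult f g); auto.
Qed.

Lemma lip_at_0_inv (m : R) (f : R -> R) :
  0 < m -> (forall t, m <= Rabs (f t)) -> lip_at_0 f -> lip_at_0 (fun t => / f t).
Proof.
  intros Hm Hlow ((C & HC) & Hf).
  assert (Hne : forall t, f t <> 0).
  { intros t E. pose proof (Hlow t) as Q. rewrite E, Rabs_R0 in Q. lra. }
  assert (Hi : 0 < / m) by (apply Rinv_0_lt_compat, Hm).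
  assert (HI : forall t, Rabs (/ f t) <= / m).
  { intros t. rewrite Rabs_inv. apply Rinv_le_contravar; [exact Hm | apply Hlow]. }
  split.
  - exists (/ m + / m * / m * C). intros t Ht. destruct (HC t Ht) as (B & D).
    pose proof (Rabs_pos (f t)).
    assert (0 <= / m * / m * C) by (apply Rmult_le_pos; nra).
    split; [pose proof (HI t); lra |].
    replace (/ f t - / f 0) with (- (/ f t * / f 0 * (f t - f 0))) by (field; auto).
    rewrite Rabs_Ropp.
    pose proof (Rabs_mult_le _ _ _ _ (Rabs_mult_le _ _ _ _ (HI t) (HI 0)) D). nra.
  - intros t. apply (continuity_pt_inv f); auto.
Qed.

Lemma regular_of_lip_at_0 (d : R) (f : R -> R) :
  d <= 1 -> lip_at_0 f -> regular d (fun _ t _ _ => f t).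
Proof.
  intros Hd ((C & HC) & Hf). apply (regular_time d C); [| auto].
  intros t Ht. apply HC. lra.
Qed.

(** Supplies the factor kap of the remainders; the Lipschitz estimate at 0 in [lip_at_0] is stated
    for this purpose. *)
Lemma regular_quotient_at_0 (d : R) (f : R -> R) :
  d <= 1 -> lip_at_0 f -> regular d (fun _ t _ _ => (f t - f 0) / t).
Proof.
  intros Hd ((C & HC) & Hf). apply (regular_time d C (fun t => (f t - f 0) / t)).
  - intros t Ht. destruct (HC t ltac:(lra)) as (_ & D).
    unfold Rdiv. rewrite Rabs_mult, Rabs_inv, (Rabs_right t) by lra.
    apply Rmult_le_reg_r with t; [lra |]. rewrite Rmult_assoc, Rinv_l, Rmult_1_r; lra.
  - intros t Ht. apply (continuity_pt_mult (fun t => f t - f 0) (fun t => / t)).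
    + apply (continuity_pt_minus f (fun _ => f 0)); [auto |].
      apply continuity_pt_const. intros ? ?. reflexivity.
    + apply (continuity_pt_inv (fun t => t)); [| lra].
      apply derivable_continuous_pt, derivable_pt_id.
Qed.

Lemma lip_of_derive (f f1 : R -> R) (B : R) :
  (forall z, derivable_pt_lim f z (f1 z)) -> (forall z, Rabs (f1 z) <= B) ->
  forall x y, Rabs (f x - f y) <= B * Rabs (x - y).
Proof.
  intros D HB x y.
  destruct (MVT_gen f y x f1) as (z & _ & ->).
  - intros z _. apply is_derive_Reals, D.
  - intros z _. apply derivable_continuous_pt. exists (f1 z). apply D.
  - rewrite Rabs_mult. apply Rmult_le_compat_r; [apply Rabs_pos | apply HB].
Qed.

Lemma lip_at_0_comp (f f1 u : R -> R) (B L : R) :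
  (forall z, derivable_pt_lim f z (f1 z)) -> (forall z, Rabs (f1 z) <= B) -> 0 < L ->
  (forall s t, Rabs (u s - u t) <= L * Rabs (s - t)) -> lip_at_0 (fun t => f (u t)).
Proof.
  intros D HB HL Hu.
  assert (HB0 : 0 <= B) by (pose proof (HB 0); pose proof (Rabs_pos (f1 0)); lra).
  assert (H : forall s t, Rabs (f (u s) - f (u t)) <= B * L * Rabs (s - t)).
  { intros s t. eapply Rle_trans; [apply (lip_of_derive f f1 B D HB) |].
    rewrite Rmult_assoc. apply Rmult_le_compat_l; [exact HB0 | apply Hu]. }
  assert (HBL : 0 <= B * L) by nra.
  split.
  - exists (Rabs (f (u 0)) + B * L). intros t Ht. pose proof (H t 0) as Q.
    rewrite Rminus_0_r, (Rabs_right t) in Q by lra.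
    pose proof (Rabs_pos (f (u 0))). split; [| nra].
    replace (f (u t)) with (f (u 0) + (f (u t) - f (u 0))) by ring.
    apply Rabs_plus_le; [lra | nra].
  - intros t eps Heps. exists (eps / (B * L + 1)).
    split; [apply Rdiv_lt_0_compat; lra |]. intros s (_ & Hs). simpl in *. unfold Rdist in *.
    assert (eps / (B * L + 1) * (B * L + 1) = eps) by (field; lra).
    pose proof (H s t). pose proof (Rabs_pos (s - t)). nra.
Qed.

(** By the mean value theorem, s - t is u s - u t times some value of - c1, and that value is at
    least m. *)
Lemma inverse_branch_lip (c c1 u : R -> R) (m : R) :
  0 < m -> (forall z, derivable_pt_lim c z (c1 z)) -> (forall z, c1 z <= - m) ->
  (forall t, c (u t) = - t) -> forall s t, Rabs (u s - u t) <= / m * Rabs (s - t).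
Proof.
  intros Hm D Hc Hu s t.
  destruct (MVT_gen c (u t) (u s) c1) as (z & _ & E).
  - intros z _. apply is_derive_Reals, D.
  - intros z _. apply derivable_continuous_pt. exists (c1 z). apply D.
  - rewrite !Hu in E. apply Rmult_le_reg_l with m; [exact Hm |].
    rewrite <- Rmult_assoc, Rinv_r, Rmult_1_l by lra.
    replace (s - t) with (- c1 z * (u s - u t)) by lra.
    rewrite Rabs_mult. apply Rmult_le_compat_r; [apply Rabs_pos |].
    rewrite Rabs_right; pose proof (Hc z); lra.
Qed.

Lemma smooth_C11 (f : R -> R) (D : nat -> R -> R) (k : nat) :
  smooth_with f D -> bounded_fn (D k) -> bounded_fn (D (S k)) -> bounded_fn (D (S (S k))) ->
  exists K, C11 K (D k).
Proof.
  intros (_ & HD) (B0 & H0) (B1 & H1) (B2 & H2).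
  exists (2 * (Rabs B0 + Rabs B1 + Rabs B2)).
  pose proof (Rabs_pos B0). pose proof (Rabs_pos B1). pose proof (Rabs_pos B2).
  pose proof (Rle_abs B0). pose proof (Rle_abs B1). pose proof (Rle_abs B2).
  apply (C11_of_derive _ _ (D (S k)) (D (S (S k)))); try apply HD; intros y.
  - eapply Rle_trans; [apply H0 | lra].
  - eapply Rle_trans; [apply H1 | lra].
  - eapply Rle_trans; [apply H2 | lra].
Qed.

(** * Four-component systems and the choice of constants *)

Definition pick4 {T : Type} (x1 x2 x3 x4 : T) (i : nat) : T :=
  match i with 1%nat => x1 | 2%nat => x2 | 3%nat => x3 | _ => x4 end.

(** Index 0 and all indices above 4 fall into the last branch, so a property of four entries holds
    at every natural number, as [small_system] requires. *)
Lemma pick4_ind {T : Type} (P : T -> Prop) (x1 x2 x3 x4 : T) :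
  P x1 -> P x2 -> P x3 -> P x4 -> forall i, P (pick4 x1 x2 x3 x4 i).
Proof. intros H1 H2 H3 H4 [|[|[|[|i]]]]; assumption. Qed.

Lemma tri_bounded_pick4 (d : R) E1 E2 E3 E4 :
  regular d E1 -> regular d E2 -> regular d E3 -> regular d E4 ->
  exists C, 0 <= C /\ forall i, tri_bounded d C (pick4 E1 E2 E3 E4 i).
Proof.
  intros ((C1 & H1) & _) ((C2 & H2) & _) ((C3 & H3) & _) ((C4 & H4) & _).
  exists (Rabs C1 + Rabs C2 + Rabs C3 + Rabs C4).
  pose proof (Rabs_pos C1). pose proof (Rabs_pos C2).
  pose proof (Rabs_pos C3). pose proof (Rabs_pos C4).
  pose proof (Rle_abs C1). pose proof (Rle_abs C2).
  pose proof (Rle_abs C3). pose proof (Rle_abs C4).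
  split; [lra |].
  apply pick4_ind; (eapply tri_bounded_weaken; [| eassumption]); lra.
Qed.

Lemma fuchsian_pick4_solvable (d0 : R) A1 A2 A3 A4 E1 E2 E3 E4 L1 L2 L3 L4 :
  0 < d0 <= 1 ->
  regular d0 A1 -> regular d0 A2 -> regular d0 A3 -> regular d0 A4 ->
  regular d0 E1 -> regular d0 E2 -> regular d0 E3 -> regular d0 E4 ->
  regular d0 L1 -> regular d0 L2 -> regular d0 L3 -> regular d0 L4 ->
  exists lam0 d K : R, 0 < lam0 <= 1 /\ 0 < d <= d0 /\ 0 < K /\ d * K <= 1 /\
  forall lam : R, Rabs lam <= lam0 ->
  exists U Ut Uy : nat -> R -> R -> R,
    class_F (16 * K) d U Ut Uy /\
    (forall i t y, 0 < t <= d -> Rabs (U i t y / t ^ 2) <= K) /\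
    forall t y, 0 < t <= d ->
      let v := fun j => U j t y / t ^ 2 in
      let w := fun j => t * v j in
      Ut 1%nat t y + t * L1 lam t y w * Uy 1%nat t y
        = t * (/ 2 * (v 1%nat - v 2%nat) + lam * (A1 lam t y w * (v 3%nat - v 4%nat))
               + E1 lam t y w) /\
      Ut 2%nat t y + t * L2 lam t y w * Uy 2%nat t y
        = t * (/ 2 * (v 2%nat - v 1%nat) + lam * (A2 lam t y w * (v 3%nat - v 4%nat))
               + E2 lam t y w) /\
      Ut 3%nat t y + t * L3 lam t y w * Uy 3%nat t y
        = t * (/ 2 * (v 3%nat - v 4%nat) + lam * (A3 lam t y w * (v 1%nat - v 2%nat))
               + E3 lam t y w) /\
      Ut 4%nat t y + t * L4 lam t y w * Uy 4%nat t y
        = t * (/ 2 * (v 4%nat - v 3%nat) + lam * (A4 lam t y w * (v 1%nat - v 2%nat))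
               + E4 lam t y w).
Proof.
  intros Hd0 HA1 HA2 HA3 HA4 HE1 HE2 HE3 HE4 HL1 HL2 HL3 HL4.
  destruct (tri_bounded_pick4 d0 A1 A2 A3 A4) as (CA & CA0 & HCA); try assumption.
  destruct (tri_bounded_pick4 d0 E1 E2 E3 E4) as (CE & CE0 & HCE); try assumption.
  destruct (tri_bounded_pick4 d0 L1 L2 L3 L4) as (CL & CL0 & HCL); try assumption.
  (* K is large enough to absorb the remainders E, and [lam0] gives |lam| CA <= 1/64. *)
  set (K := 8 * CE + 1). set (lam0 := / (64 * (CA + 1))).
  (* With d = 1/D each summand times d is at most 1; these are exactly the smallness conditions on
     d. *)
  set (D := (/ d0 + K + 8 * CE + 64 * CL * (1 + 8 * K))).
  assert (HK : 0 < K) by (unfold K; lra).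
  assert (Hi : 0 < / d0) by (apply Rinv_0_lt_compat; lra).
  assert (HCK : 0 <= CL * (1 + 8 * K)) by (apply Rmult_le_pos; lra).
  assert (HD : 0 < D) by (unfold D; lra).
  set (d := / D).
  assert (Hd : 0 < d) by (apply Rinv_0_lt_compat, HD).
  assert (EdD : d * D = 1) by (unfold d; field; lra).
  assert (Edi : d0 * / d0 = 1) by (field; lra).
  assert (Hdi : 0 <= d * / d0) by nra. assert (HdK : 0 <= d * K) by nra.
  assert (HdE : 0 <= d * CE) by nra. assert (HdL : 0 <= d * (CL * (1 + 8 * K))) by nra.
  assert (ED : d * / d0 + d * K + 8 * (d * CE) + 64 * (d * (CL * (1 + 8 * K))) = 1)
    by (transitivity (d * D); [unfold D; ring | exact EdD]).
  assert (Hdd0 : d <= d0).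
  { assert (Q : d * / d0 <= 1) by lra.
    apply Rmult_le_compat_r with (r := d0) in Q; [| lra].
    replace (d * / d0 * d0) with (d * (d0 * / d0)) in Q by ring. rewrite Edi in Q. lra. }
  assert (Hlam0 : 0 < lam0) by (apply Rinv_0_lt_compat; lra).
  assert (ElamA : lam0 * (64 * (CA + 1)) = 1) by (unfold lam0; field; lra).
  exists lam0, d, K.
  split; [nra |]. split; [lra |]. split; [exact HK |]. split; [lra |].
  intros lam Hlam.
  assert (Hlam1 : Rabs lam <= 1) by nra.
  pose proof (Rabs_pos lam) as Hlampos.
  set (A := pick4 A1 A2 A3 A4). set (E := pick4 E1 E2 E3 E4). set (L := pick4 L1 L2 L3 L4).
  assert (RA : forall i, regular d0 (A i)) by (apply (pick4_ind (regular d0)); assumption).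
  assert (RE : forall i, regular d0 (E i)) by (apply (pick4_ind (regular d0)); assumption).
  assert (RL : forall i, regular d0 (L i)) by (apply (pick4_ind (regular d0)); assumption).
  set (a := pick4 1%nat 2%nat 3%nat 4%nat). set (b := pick4 2%nat 1%nat 4%nat 3%nat).
  set (a' := pick4 3%nat 3%nat 1%nat 1%nat). set (b' := pick4 4%nat 4%nat 2%nat 2%nat).
  set (p := fun i t y (v : nat -> R) => / 2 * (v (a i) - v (b i))
       + lam * (A i lam t y (fun j => t * v j) * (v (a' i) - v (b' i)))
       + E i lam t y (fun j => t * v j)).
  set (l := fun i t y (v : nat -> R) => L i lam t y (fun j => t * v j)).
  assert (H : small_system d K CL p l).
  { unfold small_system. repeat apply conj; try lra.
    - intros i. apply (good_coef_fuchsian d0 d K CA CE lam (A i) (E i)); auto; try lra.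
      + nra.
      + unfold K. lra.
    - intros i. apply (good_coef_of_regular d0 d K CL lam (L i)); auto; lra. }
  destruct (fuchsian_system_solvable d K CL p l H) as (U & Ut & Uy & HF & HB & HE).
  exists U, Ut, Uy. split; [exact HF |]. split; [exact HB |].
  intros t y Ht v w.
  repeat split.
  - apply (HE 1%nat t y Ht).
  - apply (HE 2%nat t y Ht).
  - apply (HE 3%nat t y Ht).
  - apply (HE 4%nat t y Ht).
Qed.

(** * Reduction of the degenerate system to the Fuchsian one *)

Lemma smooth_derive (f : R -> R) (D : nat -> R -> R) (x : R) :
  smooth_with f D -> derivable_pt_lim f x (D 1%nat x).
Proof.
  intros (H0 & HD). apply is_derive_Reals. apply (is_derive_ext (D 0%nat)); [exact H0 |].
  apply is_derive_Reals, HD.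
Qed.

Lemma g11_derive (k lam y d1 d2 d3 : R) (psi1 psi2 phi : R -> R) :
  psi1 y <> 0 -> derivable_pt_lim psi1 y d1 -> derivable_pt_lim psi2 y d2 ->
  derivable_pt_lim phi y d3 ->
  derivable_pt_lim (fun z => - (k * (psi2 z * psi2 z + 2 * lam * phi z) * / psi1 z)) y
    (- (k * (2 * psi2 y * d2 + 2 * lam * d3) * / psi1 y
        - k * (psi2 y * psi2 y + 2 * lam * phi y) * d1 * (/ psi1 y * / psi1 y))).
Proof.
  intros Hne H1 H2 H3.
  apply is_derive_Reals in H1. apply is_derive_Reals in H2. apply is_derive_Reals in H3.
  apply is_derive_Reals. auto_derive.
  - repeat split; try (eexists; eassumption). exact Hne.
  - replace (Derive (fun x : R => psi1 x) y) with d1 by (symmetry; apply is_derive_unique, H1).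
    replace (Derive (fun x : R => psi2 x) y) with d2 by (symmetry; apply is_derive_unique, H2).
    replace (Derive (fun x : R => phi x) y) with d3 by (symmetry; apply is_derive_unique, H3).
    field. exact Hne.
Qed.

Theorem theorem1p3
  (c : R -> R) (Dc : nat -> R -> R) (a : R -> R) (Da : nat -> R -> R)
  (m0 : R) (phi1 : R)
  (phi2 : R -> R) (Dphi2 : nat -> R -> R)
  (psi1 : R -> R) (Dpsi1 : nat -> R -> R)
  (psi2 : R -> R) (Dpsi2 : nat -> R -> R)
  (psi0 : R)
  (ustar : R -> R)
  (dg11 : R -> R -> R) (dg21 dg22 : R -> R)
  (* c, a smooth, with c^(l), a^(l) bounded for l = 1,2,3, |a| >= m0 > 0 *)
  (Hc : smooth_with c Dc)
  (Hcb : forall l : nat, (1 <= l <= 3)%nat -> bounded_fn (Dc l))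
  (Ha : smooth_with a Da)
  (Hab : forall l : nat, (1 <= l <= 3)%nat -> bounded_fn (Da l))
  (Hm0 : 0 < m0)
  (Ham : forall z, m0 <= Rabs (a z))
  (* phi1 constant with c(phi1) = 0 *)
  (Hphi1 : c phi1 = 0)
  (* phi2, psi1, psi2 smooth with the stated bounded derivatives *)
  (Hphi2 : smooth_with phi2 Dphi2)
  (Hphi2b : forall j : nat, (1 <= j <= 4)%nat -> bounded_fn (Dphi2 j))
  (Hpsi1 : smooth_with psi1 Dpsi1)
  (Hpsi1b : forall k : nat, (k <= 3)%nat -> bounded_fn (Dpsi1 k))
  (Hpsi2 : smooth_with psi2 Dpsi2)
  (Hpsi2b : forall k : nat, (k <= 3)%nat -> bounded_fn (Dpsi2 k))
  (* additional assumptions of the theorem *)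
  (Hcm : forall z, Dc 1%nat z <= - m0)
  (Hpsi0 : 0 < psi0)
  (Hpsi1l : forall y, psi0 <= psi1 y)
  (* u_* : c(u_*(tau)) = -tau, u_*(0) = phi1 *)
  (Hus : forall t, c (ustar t) = - t)
  (Hus0 : ustar 0 = phi1)
  (* dg11 lam, dg21, dg22 are the y-derivatives of g11, g21, g22 *)
  (Hdg11 : forall lam y, derivable_pt_lim
     (g11 (a phi1) (Da 1%nat phi1) (Dc 1%nat phi1) lam psi1 psi2 (Dphi2 1%nat))
     y (dg11 lam y))
  (Hdg21 : forall y, derivable_pt_lim
     (g21 (a phi1) (Da 1%nat phi1) (Dc 1%nat phi1) psi1 psi2 (Dphi2 1%nat))
     y (dg21 y))
  (Hdg22 : forall y, derivable_pt_lim
     (g22 (a phi1) (Da 1%nat phi1) (Dc 1%nat phi1) psi1 psi2 (Dphi2 1%nat))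
     y (dg22 y)) :
  exists lam0 delta M : R, 0 < lam0 /\ 0 < delta /\ 0 < M /\
  forall lam : R, Rabs lam <= lam0 ->
  exists U Ut Uy : nat -> R -> R -> R,
    class_F M delta U Ut Uy /\
    forall t y, 0 < t <= delta ->
      let cp := Dc 1%nat (ustar t) in
      let aa := a (ustar t) in
      let da := Da 1%nat (ustar t) in
      let a1 := a phi1 in
      let da1 := Da 1%nat phi1 in
      let dc1 := Dc 1%nat phi1 in
      let G11 := g11 a1 da1 dc1 lam psi1 psi2 (Dphi2 1%nat) y in
      let G21 := g21 a1 da1 dc1 psi1 psi2 (Dphi2 1%nat) y in
      let G22 := g22 a1 da1 dc1 psi1 psi2 (Dphi2 1%nat) y in
      let R1 := U 1%nat t y + psi1 y + G11 * t in
      let S1 := U 2%nat t y + psi1 y + G11 * t in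
      let R2 := U 3%nat t y + psi2 y + G21 * t in
      let S2 := U 4%nat t y + psi2 y + G22 * t in
      let Lp := - (t / (cp * S1)) in
      let Lm := t / (cp * R1) in
      Ut 1%nat t y + Lp * Uy 1%nat t y
        = G1 lam cp aa da t R1 S1 R2 S2 G11 (dg11 lam y) (Dpsi1 1%nat y) /\
      Ut 2%nat t y + Lm * Uy 2%nat t y
        = G2 lam cp aa da t R1 S1 R2 S2 G11 (dg11 lam y) (Dpsi1 1%nat y) /\
      Ut 3%nat t y + Lp * Uy 3%nat t y
        = G3 lam cp aa da t R1 S1 R2 S2 G21 (dg21 y) (Dpsi2 1%nat y) /\
      Ut 4%nat t y + Lm * Uy 4%nat t y
        = G4 lam cp aa da t R1 S1 R2 S2 G22 (dg22 y) (Dpsi2 1%nat y).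
Proof.
  assert (Dcne : forall z, Dc 1%nat z <> 0) by (intros z; pose proof (Hcm z); lra).
  assert (Dcabs : forall z, m0 <= Rabs (Dc 1%nat z)).
  { intros z. pose proof (Hcm z). rewrite Rabs_left; lra. }
  assert (Hane : forall z, a z <> 0).
  { intros z E. pose proof (Ham z) as Q. rewrite E, Rabs_R0 in Q. lra. }
  assert (Hp1 : forall y, 0 < psi1 y) by (intros y; pose proof (Hpsi1l y); lra).
  assert (Hu : forall s t, Rabs (ustar s - ustar t) <= / m0 * Rabs (s - t)).
  { apply (inverse_branch_lip c (Dc 1%nat)); try assumption.
    intros z. apply smooth_derive, Hc. }
  assert (Him0 : 0 < / m0) by (apply Rinv_0_lt_compat, Hm0).
  set (cp := fun t => Dc 1%nat (ustar t)). set (aa := fun t => a (ustar t)).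
  set (da := fun t => Da 1%nat (ustar t)).
  assert (Lcp : lip_at_0 cp).
  { destruct (Hcb 2%nat ltac:(lia)) as (B & HB).
    apply (lip_at_0_comp (Dc 1%nat) (Dc 2%nat) ustar B (/ m0)); try assumption. apply Hc. }
  assert (Laa : lip_at_0 aa).
  { destruct (Hab 1%nat ltac:(lia)) as (B & HB).
    apply (lip_at_0_comp a (Da 1%nat) ustar B (/ m0)); try assumption.
    intros z. apply smooth_derive, Ha. }
  assert (Lda : lip_at_0 da).
  { destruct (Hab 2%nat ltac:(lia)) as (B & HB).
    apply (lip_at_0_comp (Da 1%nat) (Da 2%nat) ustar B (/ m0)); try assumption. apply Ha. }
  assert (Licp : lip_at_0 (fun t => / cp t)).
  { apply (lip_at_0_inv m0); [exact Hm0 | intros t; apply Dcabs | exact Lcp]. }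
  assert (Liaa : lip_at_0 (fun t => / aa t)).
  { apply (lip_at_0_inv m0); [exact Hm0 | intros t; apply Ham | exact Laa]. }
  set (k1 := fun t => aa t * da t * / cp t). set (k2 := fun t => da t * / aa t * / cp t).
  assert (Lk1 : lip_at_0 k1) by (apply lip_at_0_mult; [apply lip_at_0_mult |]; assumption).
  assert (Lk2 : lip_at_0 k2) by (apply lip_at_0_mult; [apply lip_at_0_mult |]; assumption).
  set (dphi := Dphi2 1%nat). set (ddphi := Dphi2 2%nat).
  set (dpsi1 := Dpsi1 1%nat). set (dpsi2 := Dpsi2 1%nat).
  (* Three consecutive bounded derivatives make the first of them C^{1,1}. As phi2'' occurs in the
     derivatives of the g_{ij}, this reaches order four for phi2. *)
  assert (Y : forall f D k, smooth_with f D -> bounded_fn (D k) -> bounded_fn (D (S k)) ->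
            bounded_fn (D (S (S k))) -> forall d, regular d (fun _ _ y _ => D k y)).
  { intros f D k HD B0 B1 B2 d. apply regular_y. apply (smooth_C11 f); assumption. }
  assert (Ydphi : forall d, regular d (fun _ _ y _ => dphi y))
    by (apply (Y phi2); auto; apply Hphi2b; lia).
  assert (Yddphi : forall d, regular d (fun _ _ y _ => ddphi y))
    by (apply (Y phi2); auto; apply Hphi2b; lia).
  assert (Ydpsi1 : forall d, regular d (fun _ _ y _ => dpsi1 y))
    by (apply (Y psi1); auto; apply Hpsi1b; lia).
  assert (Ydpsi2 : forall d, regular d (fun _ _ y _ => dpsi2 y))
    by (apply (Y psi2); auto; apply Hpsi2b; lia).
  assert (Ypsi1 : forall d, regular d (fun _ _ y _ => psi1 y)).
  { intros d. apply (regular_ext d _ (fun _ _ y _ => Dpsi1 0%nat y)).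
    - intros. symmetry. apply Hpsi1.
    - apply (Y psi1); auto; apply Hpsi1b; lia. }
  assert (Ypsi2 : forall d, regular d (fun _ _ y _ => psi2 y)).
  { intros d. apply (regular_ext d _ (fun _ _ y _ => Dpsi2 0%nat y)).
    - intros. symmetry. apply Hpsi2.
    - apply (Y psi2); auto; apply Hpsi2b; lia. }
  assert (Yipsi1 : forall d, regular d (fun _ _ y _ => / psi1 y)).
  { intros d. apply (regular_inv d psi0 (fun _ _ y _ => psi1 y)); auto. }
  set (g := fun lam y => - (k1 0 * (psi2 y * psi2 y + 2 * lam * dphi y) * / psi1 y)).
  set (h21 := fun y => 2 * k2 0 * psi2 y - dphi y).
  set (h22 := fun y => 2 * k2 0 * psi2 y + dphi y).
  set (dg := fun lam y => - (k1 0 * (2 * psi2 y * dpsi2 y + 2 * lam * ddphi y) * / psi1 y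
        - k1 0 * (psi2 y * psi2 y + 2 * lam * dphi y) * dpsi1 y * (/ psi1 y * / psi1 y))).
  assert (Ek1 : k1 0 = a phi1 * Da 1%nat phi1 * / Dc 1%nat phi1)
    by (unfold k1, aa, da, cp; rewrite Hus0; reflexivity).
  assert (Ek2 : k2 0 = Da 1%nat phi1 * / a phi1 * / Dc 1%nat phi1)
    by (unfold k2, aa, da, cp; rewrite Hus0; reflexivity).
  assert (Eg : forall lam y,
     g11 (a phi1) (Da 1%nat phi1) (Dc 1%nat phi1) lam psi1 psi2 (Dphi2 1%nat) y = g lam y).
  { intros lam y. unfold g11, f11, g, dphi. rewrite Ek1. field.
    split; [apply Rgt_not_eq, Hp1 | apply Dcne]. }
  assert (Eh21 : forall y,
     g21 (a phi1) (Da 1%nat phi1) (Dc 1%nat phi1) psi1 psi2 (Dphi2 1%nat) y = h21 y).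
  { intros y. unfold g21, f21, h21, dphi. rewrite Ek2. field.
    repeat split; first [apply Hane | apply Dcne | apply Rgt_not_eq, Hp1]. }
  assert (Eh22 : forall y,
     g22 (a phi1) (Da 1%nat phi1) (Dc 1%nat phi1) psi1 psi2 (Dphi2 1%nat) y = h22 y).
  { intros y. unfold g22, f22, h22, dphi. rewrite Ek2. field.
    repeat split; first [apply Hane | apply Dcne | apply Rgt_not_eq, Hp1]. }
  (* [dg11] is only known as a derivative; uniqueness of derivatives identifies it with an explicit
     formula, from which its regularity can be read off. The same is done for [dg21] and [dg22]. *)
  assert (Edg : forall lam y, dg11 lam y = dg lam y).
  { intros lam y. eapply uniqueness_limite; [apply Hdg11 |].
    apply is_derive_Reals. apply (is_derive_ext (g lam)); [intros z; symmetry; apply Eg |].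
    apply is_derive_Reals. apply g11_derive.
    - apply Rgt_not_eq, Hp1.
    - apply smooth_derive, Hpsi1.
    - apply smooth_derive, Hpsi2.
    - apply Hphi2. }
  assert (Edh : forall s y, derivable_pt_lim (fun z => 2 * k2 0 * psi2 z + s * dphi z) y
                  (2 * k2 0 * dpsi2 y + s * ddphi y)).
  { intros s y. apply (derivable_pt_lim_plus (fun z => 2 * k2 0 * psi2 z) (fun z => s * dphi z)).
    - apply derivable_pt_lim_scal, smooth_derive, Hpsi2.
    - apply derivable_pt_lim_scal, Hphi2. }
  assert (Edh21 : forall y, dg21 y = 2 * k2 0 * dpsi2 y + -1 * ddphi y).
  { intros y. eapply uniqueness_limite; [apply Hdg21 |].
    apply is_derive_Reals. apply (is_derive_ext (fun z => 2 * k2 0 * psi2 z + -1 * dphi z)).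
    - intros z. symmetry. etransitivity; [apply Eh21 |].
      change (h21 z = 2 * k2 0 * psi2 z + -1 * dphi z). unfold h21. ring.
    - apply is_derive_Reals, Edh. }
  assert (Edh22 : forall y, dg22 y = 2 * k2 0 * dpsi2 y + 1 * ddphi y).
  { intros y. eapply uniqueness_limite; [apply Hdg22 |].
    apply is_derive_Reals. apply (is_derive_ext (fun z => 2 * k2 0 * psi2 z + 1 * dphi z)).
    - intros z. symmetry. etransitivity; [apply Eh22 |].
      change (h22 z = 2 * k2 0 * psi2 z + 1 * dphi z). unfold h22. ring.
    - apply is_derive_Reals, Edh. }
  assert (Rg : forall d, regular d (fun lam _ y _ => g lam y)).
  { intros d. pose proof (Ydphi d). pose proof (Ypsi2 d). pose proof (Yipsi1 d).
    unfold g. regular_tac. }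
  assert (Rh21 : forall d, regular d (fun lam _ y _ => h21 y)).
  { intros d. pose proof (Ydphi d). pose proof (Ypsi2 d). unfold h21. regular_tac. }
  assert (Rh22 : forall d, regular d (fun lam _ y _ => h22 y)).
  { intros d. pose proof (Ydphi d). pose proof (Ypsi2 d). unfold h22. regular_tac. }
  assert (Rdg : forall d, regular d (fun lam _ y _ => dg11 lam y)).
  { intros d. apply (regular_ext d _ (fun lam _ y _ => dg lam y)); [intros; apply Edg |].
    pose proof (Ydphi d). pose proof (Ypsi2 d). pose proof (Yipsi1 d).
    pose proof (Yddphi d). pose proof (Ydpsi1 d). pose proof (Ydpsi2 d).
    unfold dg. regular_tac. }
  assert (Rdh21 : forall d, regular d (fun lam _ y _ => dg21 y)).
  { intros d. eapply regular_ext; [intros; apply Edh21 |].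
    pose proof (Yddphi d). pose proof (Ydpsi2 d). regular_tac. }
  assert (Rdh22 : forall d, regular d (fun lam _ y _ => dg22 y)).
  { intros d. eapply regular_ext; [intros; apply Edh22 |].
    pose proof (Yddphi d). pose proof (Ydpsi2 d). regular_tac. }
  (* The bound [Bg] of g_11, uniform in |lam| <= 1, determines the time [d0] up to which R_1 and S_1
     stay above psi0/2. *)
  destruct (Rg 1) as ((Bg & HBg) & _).
  assert (Bgv : forall lam y, Rabs lam <= 1 -> Rabs (g lam y) <= Bg).
  { intros lam y Hl. apply (tri_bounded_value 1 Bg (fun lam _ y _ => g lam y) lam 1 y (fun _ => 0));
      try assumption; [lra |]. intros _. rewrite Rabs_R0. lra. }
  assert (HBg0 : 0 <= Bg).
  { pose proof (Bgv 0 0 ltac:(rewrite Rabs_R0; lra)). pose proof (Rabs_pos (g 0 0)). lra. }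
  set (d0 := Rmin 1 (psi0 / (2 * (Bg + 1)))).
  assert (Hd0 : 0 < d0 <= 1).
  { split; [apply Rmin_glb_lt; [lra |] | apply Rmin_l]. apply Rdiv_lt_0_compat; lra. }
  assert (Hd0' : d0 * (Bg + 1) <= psi0 / 2).
  { replace (psi0 / 2) with (psi0 / (2 * (Bg + 1)) * (Bg + 1)) by (field; lra).
    apply Rmult_le_compat_r; [lra | apply Rmin_r]. }
  (* With w = U / t this is R_1 for j = 1 and S_1 for j = 2. *)
  set (Sf := fun (j : nat) lam t y (w : nat -> R) => psi1 y + g lam y * t + t * w j).
  assert (Slow : forall j lam t y w, Rabs lam <= 1 -> 0 < t <= d0 ->
            (forall j, Rabs (w j) <= 1) -> psi0 / 2 <= Sf j lam t y w).
  { intros j lam t y w Hl Ht Hw. unfold Sf.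
    pose proof (Bgv lam y Hl) as Q. apply Rabs_le_between in Q.
    pose proof (Hw j) as Q'. apply Rabs_le_between in Q'. pose proof (Hpsi1l y).
    assert (- (t * (Bg + 1)) <= g lam y * t + t * w j) by nra.
    assert (t * (Bg + 1) <= d0 * (Bg + 1)) by nra. lra. }
  pose proof (Ydphi d0). pose proof (Yipsi1 d0). pose proof (Ypsi1 d0). pose proof (Ypsi2 d0).
  pose proof (Ydpsi1 d0). pose proof (Ydpsi2 d0). pose proof (Rg d0). pose proof (Rdg d0).
  pose proof (Rh21 d0). pose proof (Rh22 d0). pose proof (Rdh21 d0). pose proof (Rdh22 d0).
  assert (RS : forall j, regular d0 (fun lam t y w => / Sf j lam t y w)).
  { intros j. apply (regular_inv d0 (psi0 / 2) (Sf j)); [lra | apply Slow |].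
    unfold Sf. regular_tac. }
  pose proof (RS 1%nat). pose proof (RS 2%nat).
  pose proof (regular_of_lip_at_0 d0 aa (proj2 Hd0) Laa).
  pose proof (regular_of_lip_at_0 d0 k1 (proj2 Hd0) Lk1).
  pose proof (regular_of_lip_at_0 d0 k2 (proj2 Hd0) Lk2).
  pose proof (regular_of_lip_at_0 d0 (fun t => / cp t) (proj2 Hd0) Licp).
  pose proof (regular_quotient_at_0 d0 k1 (proj2 Hd0) Lk1).
  pose proof (regular_quotient_at_0 d0 k2 (proj2 Hd0) Lk2).
  destruct (fuchsian_pick4_solvable d0
    (fun lam t y w => k1 t * / Sf 2%nat lam t y w)
    (fun lam t y w => k1 t * / Sf 1%nat lam t y w)
    (fun lam t y w => - (k2 t * / Sf 2%nat lam t y w))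
    (fun lam t y w => - (k2 t * / Sf 1%nat lam t y w))
    (fun lam t y w => rest12 lam 1 (/ cp t) (aa t) (k1 0) ((k1 t - k1 0) / t) t
       (/ Sf 2%nat lam t y w) (psi2 y) (dphi y) (g lam y) (dg11 lam y) (dpsi1 y)
       (h21 y) (h22 y) (w 1%nat) (w 2%nat) (w 3%nat) (w 4%nat) (w 2%nat))
    (fun lam t y w => rest12 lam (-1) (/ cp t) (aa t) (k1 0) ((k1 t - k1 0) / t) t
       (/ Sf 1%nat lam t y w) (psi2 y) (dphi y) (g lam y) (dg11 lam y) (dpsi1 y)
       (h21 y) (h22 y) (w 1%nat) (w 2%nat) (w 3%nat) (w 4%nat) (w 1%nat))
    (fun lam t y w => rest34 1 (/ cp t) (k2 t) ((k2 t - k2 0) / t) t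
       (/ Sf 2%nat lam t y w) (psi2 y) (psi2 y + t * (w 4%nat + h22 y)) (dphi y) (dg21 y)
       (dpsi2 y) (h21 y) (h22 y) (w 1%nat) (w 2%nat) (w 3%nat) (w 4%nat))
    (fun lam t y w => rest34 (-1) (/ cp t) (k2 t) ((k2 t - k2 0) / t) t
       (/ Sf 1%nat lam t y w) (psi2 y) (psi2 y + t * (w 3%nat + h21 y)) (dphi y) (dg22 y)
       (dpsi2 y) (h21 y) (h22 y) (w 1%nat) (w 2%nat) (w 3%nat) (w 4%nat))
    (fun lam t y w => - (/ cp t * / Sf 2%nat lam t y w))
    (fun lam t y w => / cp t * / Sf 1%nat lam t y w)
    (fun lam t y w => - (/ cp t * / Sf 2%nat lam t y w))
    (fun lam t y w => / cp t * / Sf 1%nat lam t y w))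
    as (lam0 & d & K & Hlam0 & Hd & HK & HdK & Hsol);
    try (unfold rest12, rest34; regular_tac); try assumption.
  exists lam0, d, (16 * K). split; [lra |]. split; [lra |]. split; [lra |].
  intros lam Hlam. destruct (Hsol lam Hlam) as (U & Ut & Uy & HF & HB & Heq).
  exists U, Ut, Uy. split; [exact HF |].
  intros t y Ht. specialize (Heq t y Ht).
  set (v := fun j => U j t y / t ^ 2) in *. cbv zeta beta in *.
  destruct Heq as (Heq1 & Heq2 & Heq3 & Heq4).
  rewrite Eg, Eh21, Eh22.
  fold dphi dpsi1 dpsi2. change (Dc 1%nat (ustar t)) with (cp t).
  change (a (ustar t)) with (aa t). change (Da 1%nat (ustar t)) with (da t).
  assert (Hv : forall j, Rabs (v j) <= K) by (intros j; apply HB, Ht).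
  assert (Hw : forall j, Rabs (t * v j) <= 1).
  { intros j. apply (scaled_le_1 K); [lra | | apply Hv]. nra. }
  assert (Hl1 : Rabs lam <= 1) by lra.
  assert (EU : forall j, U j t y = t * (t * v j)) by (intros j; unfold v; field; lra).
  set (w := fun j => t * v j) in *.
  assert (S1p := Slow 1%nat lam t y w Hl1 ltac:(lra) Hw).
  assert (S2p := Slow 2%nat lam t y w Hl1 ltac:(lra) Hw).
  assert (ES : forall j, U j t y + psi1 y + g lam y * t = Sf j lam t y w)
    by (intros j; rewrite EU; unfold Sf, w; ring).
  assert (ER2 : U 3%nat t y + psi2 y + h21 y * t = psi2 y + t * (t * v 3%nat + h21 y))
    by (rewrite EU; ring).
  assert (ES2 : U 4%nat t y + psi2 y + h22 y * t = psi2 y + t * (t * v 4%nat + h22 y))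
    by (rewrite EU; ring).
  rewrite !ES, ER2, ES2.
  (* R_1 and S_1 share psi_1 and g_11 t, so each is the other plus a term of order t^2; the
     expansions use the one in the denominator as base. *)
  assert (E12 : Sf 1%nat lam t y w = Sf 2%nat lam t y w + t * (t * v 1%nat - t * v 2%nat))
    by (unfold Sf, w; ring).
  assert (E21 : Sf 2%nat lam t y w = Sf 1%nat lam t y w + t * (t * v 2%nat - t * v 1%nat))
    by (unfold Sf, w; ring).
  assert (Eg0 : g lam y * psi1 y = - (k1 0 * (psi2 y * psi2 y + 2 * lam * dphi y))).
  { unfold g. field. apply Rgt_not_eq, Hp1. }
  assert (Egj : forall j, t * (g lam y * (t * v j + g lam y)) =
            g lam y * Sf j lam t y w + k1 0 * (psi2 y * psi2 y + 2 * lam * dphi y)).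
  { intros j. unfold Sf, w.
    replace (g lam y * (psi1 y + g lam y * t + t * (t * v j)))
      with (g lam y * psi1 y + g lam y * (g lam y * t + t * (t * v j))) by ring.
    rewrite Eg0. ring. }
  assert (Eh : h21 y = h22 y - 2 * dphi y) by (unfold h21, h22; ring).
  assert (Htne : t <> 0) by lra. assert (Hcne : cp t <> 0) by apply Dcne.
  assert (Hane' : aa t <> 0) by apply Hane.
  assert (S1ne : Sf 1%nat lam t y w <> 0) by lra.
  assert (S2ne : Sf 2%nat lam t y w <> 0) by lra.
  repeat split.
  - rewrite E12, G1_expand with (k0 := k1 0) (dphi := dphi y) by (try assumption; apply Egj).
    fold (k1 t). etransitivity; [| exact Heq1]. field. split; assumption.
  - rewrite E21, G2_expand with (k0 := k1 0) (dphi := dphi y) by (try assumption; apply Egj).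
    fold (k1 t). etransitivity; [| exact Heq2]. field. split; assumption.
  - rewrite E12, G3_expand with (k0 := k2 0) (dphi := dphi y) by (try assumption; reflexivity).
    fold (k2 t). etransitivity; [| exact Heq3]. field. split; assumption.
  - rewrite E21, G4_expand with (k0 := k2 0) (dphi := dphi y) by (try assumption; reflexivity).
    fold (k2 t). etransitivity; [| exact Heq4]. field. split; assumption.
Qed.
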